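(* For each integer $n\ge 2$ let $X_1=X_1^{(n)},\dots,X_n=X_n^{(n)}$ be independent real random variables with distribution functions $F_{n,1},\dots,F_{n,n}$, such that $\bar F_n=n^{-1}\sum_{i=1}^n F_{n,i}$ is continuous. Suppose that for every $n\ge 2$ there is a partition $\mathcal I_{n,1},\dots,\mathcal I_{n,g}$ (with $g=g(n)$) of $\{1,\dots,n\}$ such that each $\mathcal I_{n,j}$ contains at least 2 indices and $F_{n,i}=F_{n,i'}$ for all $i,i'\in\mathcal I_{n,j}$. Let $\tau\in(0,1)$ be such that $nV_n(\tau)=\sum_{i=1}^n F_{n,i}(\bar Q_n(\tau))[1-F_{n,i}(\bar Q_n(\tau))]\to\infty$ as $n\to\infty$. For $\alpha\in(0,1)$ define $$\widehat c(\alpha)=\bigl(\widehat V(\tau)/n\bigr)^{1/2}\,\Phi^{-1}(1-\alpha/2).$$ Then, for every $\alpha\in(0,1)$, as $n\to\infty$, $$P\bigl(\widehat Q(\tau-\widehat c(\alpha))<\bar Q_n(\tau)<\widehat Q(\tau+\widehat c(\alpha))\bigr)\to 1-\alpha.$$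
   Context: The quantile function of a distribution function $F$ is its left-continuous inverse $p\mapsto\inf\{x\in\mathbb R: F(x)\ge p\}$, with the usual conventions giving $-\infty$ for $p\le 0$ and $+\infty$ (infimum of the empty set) for $p>1$. $\bar Q_n$ denotes the quantile function of $\bar F_n$. The empirical distribution function is $\widehat F(x)=n^{-1}\sum_{i=1}^n \mathbf 1\{X_i\le x\}$, and $\widehat Q$ denotes its quantile function (the empirical quantile function). The heterogeneous variance is $V_n(\tau)=n^{-1}\sum_{i=1}^n F_{n,i}(\bar Q_n(\tau))[1-F_{n,i}(\bar Q_n(\tau))]$. With $m_j$ the cardinality of $\mathcal I_{n,j}$ (so $n=m_1+\cdots+m_g$), the variance estimator is $$\widehat V(\tau)=n^{-1}\sum_{j=1}^{g}\frac{1}{m_j-1}\sum_{\ell_1,\ell_2\in\mathcal I_{n,j}}\mathbf 1\{X_{\ell_1}\le\widehat Q(\tau),\,X_{\ell_2}>\widehat Q(\tau)\}.$$ $\Phi^{-1}$ is the standard normal quantile function. The partition, $g$ and $m_j$ may all depend on $n$. *)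

(* Defs.v *)
From HB Require Import structures.
From mathcomp Require Import all_boot all_order all_algebra.
From mathcomp Require Import all_classical all_reals all_analysis.

Set Implicit Arguments.
Unset Strict Implicit.
Unset Printing Implicit Defensive.

Import Order.TTheory GRing.Theory Num.Theory.
Import numFieldNormedType.Exports.

Local Open Scope classical_set_scope.
Local Open Scope ring_scope.

(* Valued in [\bar R]: the infimum is -oo when all of [R] qualifies (p <= 0,
   for a distribution function F) and +oo when no x does (p > 1). *)
Definition quantile (R : realType) (F : R -> R) (p : R) : \bar R :=
  ereal_inf [set x%:E | x in [set x : R | p <= F x]].

Definition Phi (R : realType) (x : R) : R :=
  fine (normal_prob (0 : R) 1 `]-oo, x]).

Section Sample.
Context d (T : measurableType d) (R : realType) (P : probability T R).
Variables (n : nat) (X : 'I_n -> {RV P >-> R}).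

(* Mutual independence: the product rule over every subfamily. *)
Definition independent_RVs : Prop :=
  forall (J : {set 'I_n}) (B : 'I_n -> set R),
    (forall i, measurable (B i)) ->
    P (\bigcap_(i in [set` J]) X i @^-1` B i) =
    (\prod_(i in J) P (X i @^-1` B i))%E.

Definition dfun (i : 'I_n) (x : R) : R := fine (cdf (X i) x).

Definition mean_dfun (x : R) : R := n%:R^-1 * \sum_(i < n) dfun i x.

Definition mean_quantile : R -> \bar R := quantile mean_dfun.

Definition empirical_dfun (w : T) (x : R) : R :=
  n%:R^-1 * \sum_(i < n) (X i w <= x)%R%:R.

Definition empirical_quantile (w : T) : R -> \bar R :=
  quantile (empirical_dfun w).

(* [fine] is harmless for 0 < tau < 1 (and n > 0), where the quantile is
   finite. *)
Definition het_variance (tau : R) : R :=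
  let q := fine (mean_quantile tau) in
  n%:R^-1 * \sum_(i < n) dfun i q * (1 - dfun i q).

(* The index set is partitioned into the blocks [A \in I]. *)
Definition variance_estimator (I : {set {set 'I_n}}) (tau : R) (w : T) : R :=
  let q := empirical_quantile w tau in
  n%:R^-1 * \sum_(A in I) (#|A|%:R - 1)^-1 *
    \sum_(l1 in A) \sum_(l2 in A)
      (((X l1 w)%:E <= q)%E && (q < (X l2 w)%:E)%E)%:R.

(* [quantile (@Phi R)] is finite on ]0, 1[. *)
Definition half_width (I : {set {set 'I_n}}) (tau alpha : R) (w : T) : R :=
  Num.sqrt (variance_estimator I tau w / n%:R) *
  fine (quantile (@Phi R) (1 - alpha / 2)).

End Sample.

(* Main.v *)
Require Import Defs.
From HB Require Import structures.
From mathcomp Require Import all_boot all_order all_algebra.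
From mathcomp Require Import all_classical all_reals all_analysis.
From mathcomp Require Import measurable_realfun ring lra.

Set Implicit Arguments.
Unset Strict Implicit.
Unset Printing Implicit Defensive.

Import Order.TTheory GRing.Theory Num.Theory.
Import numFieldNormedType.Exports.

Local Open Scope classical_set_scope.
Local Open Scope ring_scope.

(** Write [q] for the [tau]-quantile of the mean distribution function [F], and
    [b i] for the indicator of [X i <= q]. The [b i] are independent Bernoulli
    variables with parameters [p i] of sum [n * tau]; let [S] be their centred sum
    and [s ^+ 2] its variance, which is [n] times the heterogeneous variance.
    Inverting the empirical quantile function turns the coverage event into
    [- z * sqrt U <= S < z * sqrt U], up to the null event that some [X i] equals
    [q], where [U] is [n] times the variance estimator ([coverage_eventE],
    [half_widthE], [no_atom]). So it remains to show that [S / s] is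
    asymptotically standard normal and that [U / s ^+ 2] tends to 1 in
    probability.

    Normality is proved by Stein's method ([clt_trapezoid]). For Bernoulli
    variables there is an exact integration by parts ([bexp_ibp]) which gives, for
    [W = S / s], that the mean of [df W - W * f W] is at most [C / s] in absolute
    value when [C] is a Lipschitz constant of the derivative [df] of [f]
    ([stein_bernoulli]). Applied to a compactly supported solution of the Stein
    equation, this shows that Lipschitz test functions with compact support and
    Gaussian mean 0 have a mean of order [1 / s] under the law of [W].

    For the estimator, [U] evaluated at the true quantile is a quadratic form in
    the [b i] with mean [s ^+ 2] and, by the same integration by parts, variance at
    most [4 * s ^+ 2] ([pair_statistic_variance]). Changing one indicator changes
    [U] by at most 2 ([pair_statistic_lipschitz]), and replacing the true by the
    empirical quantile changes only [o (s ^+ 2)] indicators with high probability: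
    this follows from Chebyshev's inequality at [q] and at a second deterministic
    point [q'] with [n * (F q' - F q) = eps * s ^+ 2] ([below_quantile_close]).

    All these estimates concern functions of the indicators [X i <= x] at a fixed
    [x], so they take place on the finite space [{ffun 'I_n -> bool}] with a product
    of Bernoulli weights; [below_event_law] transports them to the sample space,
    where they bound the coverage probability from both sides ([coverage_upper],
    [coverage_lower]). The errors are small as soon as [s] is large, whatever the
    sample ([coverage_uniform]), and [s] tends to infinity by hypothesis. *)

(** * Expectation under independent Bernoulli coordinates *)

Section BernoulliExpectation.
Context {R : realFieldType} {I : finType}.
Implicit Types (p : I -> R) (b : {ffun I -> bool}) (f g : {ffun I -> bool} -> R).

(** The probability of the configuration [b] when the [b i] are independent and [b i]
    holds with probability [p i]. *)
Definition bernoulli_weight p b : R := \prod_i (if b i then p i else 1 - p i).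

Definition bexp p f : R := \sum_b bernoulli_weight p b * f b.

Definition upd b (i : I) (c : bool) : {ffun I -> bool} :=
  [ffun j => if j == i then c else b j].

Lemma upd_same b i c : upd b i c i = c.
Proof. by rewrite ffunE eqxx. Qed.

Lemma upd_other b i c j : j != i -> upd b i c j = b j.
Proof. by rewrite ffunE => /negbTE ->. Qed.

Lemma upd_upd b i c c' : upd (upd b i c) i c' = upd b i c'.
Proof. by apply/ffunP => j; rewrite !ffunE; case: eqP. Qed.

Lemma upd_id b i : upd b i (b i) = b.
Proof. by apply/ffunP => j; rewrite ffunE; case: eqP => [->|]. Qed.

Lemma eq_bexp p f g : f =1 g -> bexp p f = bexp p g.
Proof. by move=> fg; apply: eq_bigr => b _; rewrite fg. Qed.

Lemma bexpD p f g : bexp p (fun b => f b + g b) = bexp p f + bexp p g.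
Proof. by rewrite -big_split; apply: eq_bigr => b _; rewrite mulrDr. Qed.

Lemma bexpZ p (c : R) f : bexp p (fun b => c * f b) = c * bexp p f.
Proof. by rewrite mulr_sumr; apply: eq_bigr => b _; rewrite mulrCA. Qed.

Lemma bexpN p f : bexp p (fun b => - f b) = - bexp p f.
Proof. by rewrite -sumrN; apply: eq_bigr => b _; rewrite mulrN. Qed.

Lemma bexpB p f g : bexp p (fun b => f b - g b) = bexp p f - bexp p g.
Proof. by rewrite bexpD bexpN. Qed.

Lemma bexp_sum p (J : finType) (F : J -> {ffun I -> bool} -> R) :
  bexp p (fun b => \sum_j F j b) = \sum_j bexp p (F j).
Proof.
rewrite exchange_big; apply: eq_bigr => b _.
by rewrite mulr_sumr.
Qed.

Lemma bexp_cst p (c : R) : bexp p (fun=> c) = c.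
Proof.
rewrite /bexp -mulr_suml -[RHS]mul1r; congr (_ * _).
transitivity (\prod_(i : I) \sum_(c : bool) (if c then p i else 1 - p i)).
  by rewrite bigA_distr_bigA.
by rewrite big1 // => i _; rewrite big_bool /=; ring.
Qed.

(** Each configuration containing [i] is paired with the one in which [i] is
    switched off. *)
Lemma bexp_split i (F : {ffun I -> bool} -> R) :
  \sum_b F b = \sum_(b : {ffun I -> bool} | b i) (F b + F (upd b i false)).
Proof.
rewrite big_split (bigID (fun b : {ffun I -> bool} => b i)) /=; congr (_ + _).
rewrite (reindex_onto (fun b => upd b i false) (fun b => upd b i true)) /=.
  apply: eq_bigl => b; rewrite upd_same /= upd_upd.
  by apply/eqP/idP => [<-|bi]; rewrite ?upd_same // -bi upd_id.
by move=> b /negbTE bi; rewrite upd_upd -bi upd_id.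
Qed.

Lemma bernoulli_weight_upd p b i c :
  bernoulli_weight p (upd b i c) =
  (if c then p i else 1 - p i) * \prod_(j | j != i) (if b j then p j else 1 - p j).
Proof.
rewrite /bernoulli_weight (bigD1 i) //= upd_same; congr (_ * _).
by apply: eq_bigr => j ji; rewrite upd_other.
Qed.

(** Fubini for one coordinate: averaging out the value at [i] leaves the
    expectation unchanged. *)
Lemma bexp_resample p i f :
  bexp p f =
  bexp p (fun b => p i * f (upd b i true) + (1 - p i) * f (upd b i false)).
Proof.
rewrite /bexp !(bexp_split i); apply: eq_bigr => b bi.
have eb : b = upd b i true by rewrite -bi upd_id.
rewrite [in bernoulli_weight p b]eb [in f b]eb !upd_upd !bernoulli_weight_upd.
ring.
Qed.

(** Discrete integration by parts: after resampling [b i], the centred factor takes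
    the value [1 - p i] with probability [p i] and [- p i] with probability
    [1 - p i]. *)
Lemma bexp_ibp p i f :
  bexp p (fun b => ((b i)%:R - p i) * f b) =
  p i * (1 - p i) * bexp p (fun b => f (upd b i true) - f (upd b i false)).
Proof.
rewrite (bexp_resample p i) -bexpZ; apply: eq_bexp => b.
rewrite !upd_same /=; ring.
Qed.

Section Monotone.
Variable p : I -> R.
Hypothesis p01 : forall i, 0 <= p i <= 1.

Lemma bernoulli_weight_ge0 b : 0 <= bernoulli_weight p b.
Proof.
by apply: prodr_ge0 => i _; have /andP[p0 p1] := p01 i; case: ifP; rewrite ?subr_ge0.
Qed.

Lemma ler_bexp f g : (forall b, f b <= g b) -> bexp p f <= bexp p g.
Proof.
by move=> fg; apply: ler_sum => b _; rewrite ler_wpM2l ?bernoulli_weight_ge0.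
Qed.

Lemma bexp_ge0 f : (forall b, 0 <= f b) -> 0 <= bexp p f.
Proof. by move=> f0; rewrite -(bexp_cst p 0); exact: ler_bexp. Qed.

Lemma bexp_abs f : `|bexp p f| <= bexp p (fun b => `|f b|).
Proof.
rewrite ler_norml -bexpN; apply/andP; split; apply: ler_bexp => b.
  by rewrite lerNnormlW.
exact: ler_norm.
Qed.

Lemma bexp_abs_le f c : (forall b, `|f b| <= c) -> `|bexp p f| <= c.
Proof.
move=> fc; apply: (le_trans (bexp_abs _)).
by rewrite -[leRHS](bexp_cst p); exact: ler_bexp.
Qed.

Lemma bexp_chebyshev f (t : R) : 0 < t ->
  bexp p (fun b => (t < `|f b|)%R%:R) <= bexp p (fun b => f b ^+ 2) / t ^+ 2.
Proof.
move=> t0; rewrite mulrC -bexpZ; apply: ler_bexp => b.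
have t20 : 0 < t ^+ 2 by rewrite exprn_gt0.
rewrite mulrC; case: ltP => [tf|_]; last by rewrite divr_ge0 ?sqr_ge0 ?ltW.
rewrite ler_pdivlMr // mul1r -[leRHS]real_normK ?num_real //.
by rewrite ler_sqr ?nnegrE ?normr_ge0 ?ltW.
Qed.

End Monotone.

Definition variance_sum p : R := \sum_i p i * (1 - p i).

Definition centered_sum p b : R := \sum_i ((b i)%:R - p i).

Lemma centered_sum_upd p b i :
  centered_sum p (upd b i true) - centered_sum p (upd b i false) = 1.
Proof.
rewrite /centered_sum -sumrB (bigD1 i) //= !upd_same big1 ?addr0 => [|j ji].
  by rewrite /=; ring.
by rewrite !upd_other // subrr.
Qed.

(** The Bernoulli counterpart of the Gaussian identity [E (Z * f Z) = E (f' Z)]. *)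
Lemma bexp_centered_sum_mul p f :
  bexp p (fun b => centered_sum p b * f b) =
  \sum_i p i * (1 - p i) * bexp p (fun b => f (upd b i true) - f (upd b i false)).
Proof.
rewrite (eq_bexp _ (g := fun b => \sum_i ((b i)%:R - p i) * f b)); last first.
  by move=> b; rewrite mulr_suml.
by rewrite bexp_sum; apply: eq_bigr => i _; exact: bexp_ibp.
Qed.

Lemma bexp_centered_sum2 p :
  bexp p (fun b => centered_sum p b ^+ 2) = variance_sum p.
Proof.
rewrite (eq_bexp _ (g := fun b => centered_sum p b * centered_sum p b)); last first.
  by move=> b; rewrite expr2.
rewrite bexp_centered_sum_mul; apply: eq_bigr => i _.
rewrite (eq_bexp _ (g := fun=> 1)); last by move=> b; exact: centered_sum_upd.
by rewrite bexp_cst mulr1.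
Qed.

End BernoulliExpectation.

(** * The quadratic form behind the variance estimator *)

Section PairStatistic.
Context {R : realFieldType} {I : finType}.
Variables (p : I -> R) (a : I -> I -> R).
Hypothesis p01 : forall i, 0 <= p i <= 1.
Hypothesis a_ge0 : forall i j, 0 <= a i j.
Hypothesis a_sym : forall i j, a i j = a j i.
Hypothesis a_diag : forall i, a i i = 0.
Hypothesis a_row : forall i, \sum_j a i j = 1.
Hypothesis a_supp : forall i j, a i j != 0 -> p i = p j.
Implicit Type b : {ffun I -> bool}.

(** With weight [1 / (m - 1)] between distinct members of a block of size [m], this
    is [n] times the variance estimator, [b i] telling whether observation [i] is
    at most the quantile. *)
Definition pair_statistic b : R :=
  \sum_i \sum_j a i j * ((b i)%:R * (1 - (b j)%:R)).

Lemma a_col j : \sum_i a i j = 1.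
Proof. by rewrite -(a_row j); apply: eq_bigr => i _. Qed.

(** Row and column sums of [a] are 1, so each coordinate carries total weight 2. *)
Lemma pair_statistic_lipschitz b b' :
  `|pair_statistic b - pair_statistic b'| <= 2 * \sum_i `|(b i)%:R - (b' i)%:R|.
Proof.
rewrite /pair_statistic -sumrB.
apply: (@le_trans _ _ (\sum_i \sum_j a i j *
    (`|(b i)%:R - (b' i)%:R| + `|(b j)%:R - (b' j)%:R|))).
  apply: (le_trans (ler_norm_sum _ _ _)); apply: ler_sum => i _.
  rewrite -sumrB; apply: (le_trans (ler_norm_sum _ _ _)); apply: ler_sum => j _.
  rewrite -mulrBr normrM (ger0_norm (a_ge0 _ _)) ler_wpM2l //.
  by case: (b i) (b' i) (b j) (b' j) => [] [] [] []; rewrite /=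
      ?(mul1r, mul0r, subrr, subr0, sub0r, oppr0, normrN, normr0, normr1); lra.
under eq_bigr do under eq_bigr do rewrite mulrDr.
under eq_bigr do rewrite big_split /=.
rewrite big_split /= [X in _ + X]exchange_big /= mulr_natl mulr2n.
under eq_bigr do rewrite -mulr_suml a_row mul1r.
by under [X in _ + X]eq_bigr do rewrite -mulr_suml a_col mul1r.
Qed.

(** The coefficient of [(b i)%:R - p i] in the centred statistic. *)
Definition pair_score b i : R :=
  1 - 2 * p i - \sum_j a i j * ((b j)%:R - p j).

(** Since [p] is constant along pairs of nonzero weight, the constant term of
    [b i * (1 - b j)] sums to the variance and the linear terms to
    [1 - 2 * p i]. *)
Lemma pair_statistic_decomp b :
  pair_statistic b - variance_sum p =
  \sum_i ((b i)%:R - p i) * pair_score b i.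
Proof.
have -> : pair_statistic b = \sum_i \sum_j
   (a i j * (p i * (1 - p i)) + a i j * (((b i)%:R - p i) * (1 - p i))
    - a i j * (((b j)%:R - p j) * p j)
    - ((b i)%:R - p i) * (a i j * ((b j)%:R - p j))).
  apply: eq_bigr => i _; apply: eq_bigr => j _.
  have [->|/a_supp pij] := eqVneq (a i j) 0; first by ring.
  by rewrite pij; ring.
under eq_bigr do rewrite !(sumrB, big_split) /= -!mulr_suml a_row !mul1r -mulr_sumr.
rewrite !(sumrB, big_split) /= [X in _ - X - _ - _]exchange_big /=.
under [X in _ - X - _ - _]eq_bigr do rewrite -mulr_suml a_col mul1r.
rewrite /variance_sum -big_split -!sumrB /=; apply: eq_bigr => i _.
by rewrite /pair_score /=; ring.
Qed.

Lemma pair_score_upd b i c : pair_score (upd b i c) i = pair_score b i.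
Proof.
congr (_ - _); apply: eq_bigr => j _.
by have [->|ji] := eqVneq j i; rewrite ?a_diag ?mul0r // upd_other.
Qed.

Lemma pair_score_le2 b i : `|pair_score b i| <= 2.
Proof.
apply: (le_trans (ler_normB _ _)).
have /andP[p0 p1] := p01 i.
rewrite (_ : 2 = 1 + 1) //; apply: lerD.
  by rewrite ler_norml; apply/andP; split; lra.
apply: (le_trans (ler_norm_sum _ _ _)); rewrite -[leRHS](a_row i); apply: ler_sum => j _.
rewrite normrM (ger0_norm (a_ge0 _ _)) -[leRHS]mulr1 ler_wpM2l //.
have /andP[q0 q1] := p01 j.
by rewrite ler_norml; case: (b j); rewrite /= ?mulr1n ?mulr0n; apply/andP; split; lra.
Qed.

(** Since the score of [i] does not see [b i], integration by parts turns the
    second moment into a sum of [p i * (1 - p i)] times bounded increments. *)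
Lemma pair_statistic_variance :
  bexp p (fun b => (pair_statistic b - variance_sum p) ^+ 2) <= 4 * variance_sum p.
Proof.
set D := fun b => pair_statistic b - variance_sum p.
rewrite (eq_bexp _ (g := fun b => \sum_i ((b i)%:R - p i) * (pair_score b i * D b))); last first.
  move=> b; rewrite expr2 {1}pair_statistic_decomp mulr_suml.
  by apply: eq_bigr => i _; rewrite mulrA.
rewrite bexp_sum mulr_sumr; apply: ler_sum => i _.
rewrite bexp_ibp mulrC ler_wpM2r //.
  by have /andP[p0 p1] := p01 i; rewrite mulr_ge0 ?subr_ge0.
apply: (le_trans (ler_norm _)); apply: bexp_abs_le => // b.
rewrite !pair_score_upd -mulrBr normrM (_ : 4 = 2 * 2); last by ring.
rewrite ler_pM ?normr_ge0 ?pair_score_le2 //.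
rewrite /D opprB addrA subrK; apply: (le_trans (pair_statistic_lipschitz _ _)).
rewrite (bigD1 i) //= !upd_same big1 => [|j ji].
  by rewrite /= subr0 normr1 addr0 mulr1.
by rewrite !upd_other // subrr normr0.
Qed.

End PairStatistic.

(** * Means under the standard normal density *)

Section GaussianMean.
Context {R : realType}.
Local Notation mu := (@lebesgue_measure R).
Local Notation phi := (normal_pdf (0 : R) 1).
Implicit Types h g : R -> R.

Definition gauss_mean h : R := \int[mu]_x (h x * phi x).

(** The reciprocal of the standard normal density. *)
Definition inv_phi (x : R) : R := expR (x ^+ 2 / 2) / normal_peak 1.

Lemma phiE x : phi x = normal_peak 1 * expR (- (x ^+ 2 / 2)).
Proof.
rewrite normal_pdfE ?oner_neq0 // -[LHS]/(normal_peak 1 * normal_fun 0 1 x).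
by rewrite /normal_fun subr0 expr1n mulNr.
Qed.

Lemma phi_inv_phi x : phi x * inv_phi x = 1.
Proof.
rewrite phiE /inv_phi [expR _ / _]mulrC mulrACA -expRD addNr expR0 mulr1 divff //.
by rewrite gt_eqF // normal_peak_gt0 // oner_neq0.
Qed.

Lemma is_derive_inv_phi (x : R) : is_derive x (1 : R) inv_phi (x * inv_phi x).
Proof.
rewrite /inv_phi.
have H : is_derive x (1 : R) (fun y : R => y ^+ 2 / 2) x.
  apply: is_derive_eq; rewrite /GRing.scale /= ; lra.
have H2 := @is_derive1_comp R expR (fun y : R => y ^+ 2 / 2) x _ _
  (is_derive_expR _) H.
have -> : (fun x0 : R => expR (x0 ^+ 2 / 2) / normal_peak 1)
   = (expR \o (fun y : R => y ^+ 2 / 2)) * cst (normal_peak 1)^-1 by [].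
apply: is_derive_eq; rewrite /GRing.scale /= ; ring.
Qed.

Lemma gauss_integrable h M (D : set R) : measurable D -> measurable_fun setT h ->
  (forall x, `|h x| <= M) -> mu.-integrable D (fun x => (h x * phi x)%:E).
Proof.
move=> mD mh hM; apply: (@integrableS _ _ _ mu setT) => //.
under eq_fun do rewrite EFinM.
apply: integrableMr => //; last exact: integrable_normal_pdf.
exists M; split; first exact: num_real.
by move=> y My x _ /=; exact: (le_trans (hM x) (ltW My)).
Qed.

Lemma ler_gauss_mean h g M : measurable_fun setT h -> measurable_fun setT g ->
  (forall x, `|h x| <= M) -> (forall x, `|g x| <= M) ->
  (forall x, h x <= g x) -> gauss_mean h <= gauss_mean g.
Proof.
move=> mh mg hM gM hg; apply: le_Rintegral => //.
- exact: gauss_integrable hM.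
- exact: gauss_integrable gM.
- by move=> x _; rewrite ler_wpM2r ?normal_pdf_ge0.
Qed.

Lemma gauss_meanB h g M c : measurable_fun setT h -> measurable_fun setT g ->
  (forall x, `|h x| <= M) -> (forall x, `|g x| <= M) ->
  gauss_mean (fun x => h x - c * g x) = gauss_mean h - c * gauss_mean g.
Proof.
move=> mh mg hM gM; rewrite /gauss_mean.
have ih : mu.-integrable setT (EFin \o (fun x => h x * phi x)).
  exact: gauss_integrable hM.
have ig : mu.-integrable setT (EFin \o (fun x => g x * phi x)).
  exact: gauss_integrable gM.
rewrite -RintegralZl // -RintegralB //; last first.
  by apply: eq_integrable (integrableZl _ c ig).
by apply: eq_Rintegral => x _ /=; ring.
Qed.

Lemma gauss_mean_indic (A : set R) : measurable A ->
  gauss_mean \1_A = fine (normal_prob 0 1 A).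
Proof.
move=> mA; transitivity (\int[mu]_(x in A) phi x); last by [].
rewrite Rintegral_mkcond.
apply: eq_Rintegral => x _; rewrite patchE indicE.
by case: (x \in A); rewrite ?mul1r ?mul0r.
Qed.

Lemma lipschitz_fun_continuous g L : (forall x y, `|g x - g y| <= L * `|x - y|) ->
  continuous g.
Proof.
move=> gL x; apply/cvgrPdist_le => e e0.
have L0 : 0 < `|L| + 1 by rewrite ltr_wpDl.
near=> y; apply: (le_trans (gL x y)).
apply: (@le_trans _ _ ((`|L| + 1) * `|x - y|)).
  by rewrite ler_wpM2r // (le_trans (ler_norm L)) // lerDl.
rewrite -ler_pdivlMl // mulrC; near: y.
by apply: cvgr_dist_le; [exact: cvg_id | rewrite divr_gt0].
Unshelve. all: by end_near. Qed.

End GaussianMean.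

(** * Stein's equation *)

Section SteinEquation.
Context {R : realType}.
Local Notation mu := (@lebesgue_measure R).
Local Notation phi := (normal_pdf (0 : R) 1).
Variables (g : R -> R) (L M K : R).
Hypothesis K_gt0 : 0 < K.
Hypothesis g_lip : forall x y, `|g x - g y| <= L * `|x - y|.
Hypothesis g_bound : forall x, `|g x| <= M.
Hypothesis g_supp : forall x, K <= `|x| -> g x = 0.
Hypothesis g_mean0 : gauss_mean g = 0.

Let g_cont : continuous g.
Proof. exact: lipschitz_fun_continuous g_lip. Qed.

Let g_meas : measurable_fun setT g.
Proof. exact: continuous_measurable_fun. Qed.

Let gphi_int (D : set R) : measurable D ->
  mu.-integrable D (EFin \o (fun x => g x * phi x)).
Proof. by move=> mD; exact: gauss_integrable g_bound. Qed.

Definition stein_primitive (x : R) : R := \int[mu]_(t in `]-oo, x]) (g t * phi t).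

(** The solution of [f' x = x * f x + g x] that vanishes at infinity: the integrating
    factor of this linear equation is the normal density. *)
Definition stein_solution (x : R) : R := stein_primitive x * inv_phi x.

Lemma is_derive_stein_primitive (x : R) : is_derive x (1 : R) stein_primitive (g x * phi x).
Proof.
have cphi : {for x, continuous phi}.
  by apply: continuous_normal_pdf; rewrite oner_neq0.
have cgphi : {for x, continuous (g \* phi)} by apply: continuousM => //; exact: g_cont.
have xx1 : x < x + 1 by rewrite ltrDl.
have [dA A'] := @continuous_FTC1 R (g \* phi) -oo%O x (x + 1) xx1
  (gphi_int (measurable_itv _)) (ltNyr _) cgphi.
by apply: DeriveDef; [exact: dA | rewrite -derive1E A'].
Qed.

Lemma is_derive_stein_solution (x : R) :
  is_derive x (1 : R) stein_solution (x * stein_solution x + g x).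
Proof.
have D1 := is_derive_stein_primitive x.
have D2 := is_derive_inv_phi x.
have -> : stein_solution = stein_primitive * inv_phi by [].
apply: is_derive_eq; rewrite /stein_solution /GRing.scale /=.
transitivity (x * (stein_primitive x * inv_phi x) + g x * (phi x * inv_phi x)).
  by ring.
by rewrite phi_inv_phi mulr1.
Qed.

(** To the left of [- K] nothing has been integrated yet; to the right of [K] the
    whole Gaussian mean of [g], which is 0, has been. *)
Lemma stein_solution_supp x : K <= `|x| -> stein_solution x = 0.
Proof.
move=> Kx; rewrite /stein_solution (_ : stein_primitive x = 0) ?mul0r //.
move: Kx; rewrite ler_normr => /orP[Kx|Kx]; rewrite /stein_primitive.
  rewrite -[RHS]g_mean0 /gauss_mean Rintegral_mkcond; apply: eq_Rintegral => t _.
  rewrite patchE; case: ifPn => // /negP; rewrite inE /= in_itv /= => /negP.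
  rewrite -ltNge => xt; rewrite g_supp ?mul0r // (le_trans Kx) //.
  by rewrite (le_trans (ltW xt)) // ler_norm.
transitivity (\int[mu]_(t in `]-oo, x]) (0 : R)); last by rewrite Rintegral_cst // mul0r.
apply: eq_Rintegral => t; rewrite inE /= in_itv /= => tx; rewrite g_supp ?mul0r //.
by rewrite (le_trans Kx) // -normrN (le_trans _ (ler_norm _)) // lerN2.
Qed.

Let M_ge0 : 0 <= M.
Proof. exact: le_trans (g_bound 0). Qed.

Let inv_phi_ge0 : 0 <= inv_phi K.
Proof. by rewrite divr_ge0 ?expR_ge0 ?normal_peak_ge0. Qed.

Let slope_ge0 : 0 <= K * (M * inv_phi K) + M.
Proof. exact: addr_ge0 (mulr_ge0 (ltW K_gt0) (mulr_ge0 M_ge0 inv_phi_ge0)) M_ge0. Qed.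

Lemma stein_solution_bound x : `|stein_solution x| <= M * inv_phi K.
Proof.
have [Kx|xK] := leP K `|x|.
  by rewrite stein_solution_supp // normr0 mulr_ge0.
rewrite normrM ler_pM // /inv_phi; last first.
  rewrite ger0_norm ?divr_ge0 ?expR_ge0 ?normal_peak_ge0 //.
  rewrite ler_wpM2r ?invr_ge0 ?normal_peak_ge0 // ler_expR ler_wpM2r //.
  by rewrite -[leLHS]real_normK ?num_real // ler_sqr ?nnegrE ?normr_ge0 ?ltW.
have i1 : mu.-integrable `]-oo, x] (EFin \o (fun t => M * phi t)).
  by apply: (@gauss_integrable R (cst M) M) => // t; rewrite ger0_norm.
apply: (le_trans (le_normr_Rintegral _ (gphi_int _))) => //.
apply: (@le_trans _ _ (\int[mu]_(t in `]-oo, x]) (M * phi t))).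
  apply: le_Rintegral => //.
    by apply: eq_integrable (integrable_norm (gphi_int _)).
  by move=> t _; rewrite normrM (ger0_norm (normal_pdf_ge0 _ _ _)) ler_wpM2r ?normal_pdf_ge0.
rewrite RintegralZl //; last by apply: integrableS (integrable_normal_pdf 0 1).
rewrite -[leRHS]mulr1 ler_wpM2l // -lee_fin fineK.
  exact: (@probability_le1 _ _ _ (normal_prob 0 1)).
exact: (@fin_num_measure _ _ _ (normal_prob 0 1)).
Qed.

Definition stein_const : R := M * inv_phi K + K * (K * (M * inv_phi K) + M) + L.

Lemma stein_solution_derive_bound x :
  `|x * stein_solution x + g x| <= K * (M * inv_phi K) + M.
Proof.
have [Kx|xK] := leP K `|x|.
  by rewrite stein_solution_supp // g_supp // mulr0 addr0 normr0.
rewrite (le_trans (ler_normD _ _)) // lerD // normrM ler_pM //.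
  exact: ltW.
exact: stein_solution_bound.
Qed.

Lemma stein_solution_lipschitz x y :
  `|stein_solution x - stein_solution y| <= (K * (M * inv_phi K) + M) * `|x - y|.
Proof.
wlog yx : x y / y <= x.
  move=> H; have [/H//|/ltW/H] := leP y x.
  by rewrite [`|stein_solution y - _|]distrC [`|y - x|]distrC.
have [|c _ ->] := @MVT_segment _ stein_solution _ _ _ yx (fun x _ => is_derive_stein_solution x).
  apply: continuous_subspaceT => z.
  by have [dz _] := is_derive_stein_solution z; apply: differentiable_continuous; exact/derivable1_diffP.
by rewrite normrM ler_wpM2r // stein_solution_derive_bound.
Qed.

(** [stein_solution] has a Lipschitz derivative because it solves the equation and
    vanishes, like [g], outside the compact interval. *)
Lemma stein_solution_derive_lipschitz x y :
  `|(x * stein_solution x + g x) - (y * stein_solution y + g y)|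
  <= stein_const * `|x - y|.
Proof.
rewrite opprD addrACA (le_trans (ler_normD _ _)) // /stein_const [leRHS]mulrDl.
rewrite lerD ?g_lip //.
wlog yK : x y / `|y| < K.
  move=> H; have [Ky|/H//] := leP K `|y|; have [Kx|/H] := leP K `|x|.
    rewrite !stein_solution_supp // !mulr0 subrr normr0 mulr_ge0 //.
    exact: addr_ge0 (mulr_ge0 M_ge0 inv_phi_ge0) (mulr_ge0 (ltW K_gt0) slope_ge0).
  by rewrite distrC [`|x - y|]distrC; apply.
rewrite (_ : _ - _ = (x - y) * stein_solution x +
   y * (stein_solution x - stein_solution y)); last by ring.
rewrite (le_trans (ler_normD _ _)) // [leRHS]mulrDl.
rewrite [`|(x - y) * _|]normrM [`|y * _|]normrM lerD //.
  by rewrite [leLHS]mulrC ler_wpM2r // stein_solution_bound.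
by rewrite -mulrA ler_pM ?normr_ge0 // ?stein_solution_lipschitz // ltW.
Qed.

End SteinEquation.

(** * Quantiles *)

Section Quantile.
Context {R : realType}.
Implicit Types (F : R -> R) (p x : R).

Lemma quantile_lt F p x :
  ((quantile F p < x%:E)%E <-> exists2 y, y < x & p <= F y).
Proof.
split=> [/ereal_inf_lt[_ [y /= pFy <-]]|[y yx pFy]].
  by rewrite lte_fin => yx; exists y.
apply: (@le_lt_trans _ _ y%:E); last by rewrite lte_fin.
by apply: ereal_inf_lbound; exists y.
Qed.

(** The Galois connection between a distribution function and its quantile
    function; the second hypothesis is the form of right continuity it needs. *)
Lemma quantile_le F p x : {homo F : y z / y <= z} ->
  (F x < p -> exists2 y, x < y & F y < p) ->
  (quantile F p <= x%:E)%E = (p <= F x).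
Proof.
move=> Fmono Fright; apply/idP/idP => [Qx|pFx].
  rewrite leNgt; apply/negP => /Fright[y xy Fyp].
  have : (y%:E <= quantile F p)%E.
    apply: le_ereal_inf_tmp => _ [z /= pFz <-]; rewrite lee_fin leNgt.
    by apply/negP => zy; have := Fmono _ _ (ltW zy); lra.
  by move=> /le_trans/(_ Qx); rewrite lee_fin leNgt xy.
by apply: ereal_inf_lbound; exists x.
Qed.

Lemma continuous_right_lt F p x : {for x, continuous F} -> F x < p ->
  exists2 y, x < y & F y < p.
Proof.
move=> cF Fxp.
have near_lt : \forall z \near x, F z < p by exact: (cvgr_lt (F x) cF).
have [e /= e0 He] := (nbhs_ballP _ _).1 near_lt; exists (x + e / 2); first by rewrite ltrDl divr_gt0.
apply: He; rewrite /ball /= opprD addrA subrr sub0r normrN gtr0_norm ?divr_gt0 //.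
by rewrite ltr_pdivrMr // ltr_pMr // ltr1n.
Qed.

(** [F] takes the value [p] at some [c] by the intermediate value theorem; the Galois
    connection gives [q <= c] and [p <= F q], and monotonicity does the rest. *)
Lemma quantile_continuous F p : {homo F : y z / y <= z} -> continuous F ->
  (exists x, F x < p) -> (exists x, p < F x) ->
  exists2 q, quantile F p = q%:E & F q = p.
Proof.
move=> Fmono Fcont [x Fxp] [z pFz].
have qle y : (quantile F p <= y%:E)%E = (p <= F y).
  by apply: quantile_le => // ?; apply: continuous_right_lt => //; exact: Fcont.
have xz : x <= z by rewrite leNgt; apply/negP => /ltW/Fmono; lra.
have [||c cxz Fc] := @IVT _ F x z p xz.
- exact: continuous_subspaceT.
- by rewrite ge_min le_max (ltW Fxp) (ltW pFz) orbT.
have Qc : (quantile F p <= c%:E)%E by rewrite qle Fc.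
have Qx : (x%:E < quantile F p)%E by rewrite ltNge qle -ltNge.
case EQ : (quantile F p) Qc Qx => [q| |] // Qc Qx; exists q => //.
apply/eqP; rewrite eq_le -qle EQ lexx andbT -Fc.
exact: Fmono.
Qed.

End Quantile.

(** * The standard normal distribution function *)

Section NormalDistribution.
Context {R : realType}.
Local Notation mu := (@lebesgue_measure R).
Local Notation phi := (normal_pdf (0 : R) 1).
Local Notation N01 := (normal_prob (0 : R) 1).

Definition central_prob (a : R) : R := fine (N01 `[- a, a]).

Let N01_fin (A : set R) : measurable A -> N01 A \is a fin_num.
Proof. by move=> mA; exact: fin_num_measure. Qed.

Lemma central_prob_ge0 a : 0 <= central_prob a.
Proof. by rewrite fine_ge0. Qed.

Lemma central_prob_le1 a : central_prob a <= 1.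
Proof. by rewrite -lee_fin fineK ?N01_fin //; exact: (@probability_le1 _ _ _ N01). Qed.

Lemma central_prob_le a b : a <= b -> central_prob a <= central_prob b.
Proof.
move=> ab; rewrite fine_le ?N01_fin // le_measure ?inE //.
by apply: subset_itv; rewrite bnd_simp ?lerN2.
Qed.

Lemma central_prob_near1 e : 0 < e ->
  exists2 K0, 0 < K0 & forall K, K0 <= K -> 1 - e <= central_prob K.
Proof.
move=> e0.
have : N01 \o (fun n : nat => `[- n%:R, n%:R]%classic) @ \oo --> N01 (\bigcup_n `[- n%:R, n%:R]%classic).
  apply: nondecreasing_cvg_mu => //; first exact: bigcup_measurable.
  move=> n m nm; apply/subsetPset; apply: subset_itv; rewrite bnd_simp ?lerN2 ler_nat //.
have -> : (\bigcup_n `[- n%:R, n%:R]%classic) = [set: R].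
  rewrite -subTset => x _; exists (Num.truncn `|x|).+1 => //=.
  by rewrite in_itv /= -ler_norml ltW // truncnS_gt.
rewrite (@probability_setT _ _ _ N01) => /fine_cvgP[_ cv].
have /cvgrPdist_le/(_ e e0)[n _ Hn] := cv.
exists n.+1%:R => // K nK; apply: (le_trans _ (central_prob_le nK)).
have := Hn n.+1 (leqnSn n); rewrite /= ler_norml => /andP[_].
by rewrite -/(central_prob _); lra.
Qed.

Lemma Phi_sub x y : x <= y -> Phi y - Phi x = fine (N01 `]x, y]).
Proof.
move=> xy; rewrite /Phi -fineB ?N01_fin //; congr fine.
have -> : `]-oo, y]%classic = `]-oo, x] `|` `]x, y] :> set R.
  by rewrite -itv_bndbnd_setU // bnd_simp.
rewrite (measureU N01) //; last first.
  by apply/seteqP; split => t //= []; rewrite !in_itv /=; case: (ltP x t) => // ? + /andP[]; lra.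
by rewrite addeAC subee ?N01_fin // add0e.
Qed.

Lemma Phi_le x y : x <= y -> Phi x <= Phi y :> R.
Proof. by move=> xy; rewrite -subr_ge0 Phi_sub // fine_ge0. Qed.

Lemma Phi_lipschitz x y : x <= y -> Phi y - Phi x <= normal_peak 1 * (y - x) :> R.
Proof.
move=> xy; rewrite Phi_sub // -lee_fin fineK ?N01_fin // /normal_prob.
apply: (@le_trans _ _ (\int[mu]_(t in `]x, y]) (normal_peak 1)%:E)%E).
  apply: ge0_le_integral => //.
  - by move=> t _; rewrite lee_fin normal_pdf_ge0.
  - by apply/measurable_EFinP/measurable_funTS; exact: measurable_normal_pdf.
  - by move=> t _; rewrite lee_fin normal_pdf_ub ?oner_neq0.
rewrite integral_cst //=  lebesgue_measure_itv /= lte_fin EFinM.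
by case: ifPn => // _; rewrite mule0 lee_fin mulr_ge0 ?normal_peak_ge0 // subr_ge0.
Qed.

Lemma Phi_continuous : continuous (@Phi R).
Proof.
apply: (@lipschitz_fun_continuous _ _ (normal_peak 1)) => x y.
wlog xy : x y / x <= y.
  move=> H; have [/H//|/ltW/H] := leP x y.
  by rewrite [`|Phi y - _|]distrC [`|y - x|]distrC.
rewrite distrC [`|x - y|]distrC !ger0_norm ?subr_ge0 ?Phi_le //.
exact: Phi_lipschitz.
Qed.

Lemma Phi_opp a : Phi (- a) = 1 - Phi a :> R.
Proof.
have phi_even x : phi (- x) = phi x by rewrite !phiE sqrrN.
have mphi (D : set R) : measurable D -> measurable_fun D (fun x : R => (phi x)%:E).
  by move=> mD; apply/measurable_EFinP/measurable_funTS; exact: measurable_normal_pdf.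
have e1 : N01 `]-oo, (- a)] = N01 `]a, +oo[.
  rewrite /normal_prob ge0_integration_by_substitutionNy.
  - rewrite (@integral_itv_obnd_cbnd R a +oo%O _ (mphi _ (measurable_itv _))).
    by apply: eq_integral => x _ /=; rewrite phi_even.
  - by apply: continuous_subspaceT; apply: continuous_normal_pdf; rewrite oner_neq0.
  - by move=> x _; exact: normal_pdf_ge0.
rewrite /Phi e1 -setCitvl (@probability_setC _ _ _ N01) //.
by rewrite fineB ?N01_fin.
Qed.

Lemma central_probE a : 0 <= a -> central_prob a = 2 * Phi a - 1.
Proof.
move=> a0; rewrite /central_prob.
have mphi : measurable_fun `](- a), a] (fun x : R => (phi x)%:E).
  by apply/measurable_EFinP/measurable_funTS; exact: measurable_normal_pdf.
have -> : N01 `[- a, a] = N01 `](- a), a].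
  exact: esym (@integral_itv_obnd_cbnd R (- a) (BRight a) _ mphi).
rewrite -Phi_sub ?Phi_opp; first by lra.
lra.
Qed.

Lemma quantile_PhiE u : 1 / 2 < u < 1 ->
  exists z, [/\ 0 < z, quantile (@Phi R) u = z%:E & Phi z = u].
Proof.
move=> /andP[u2 u1].
have [||z Qz Phiz] := @quantile_continuous R (@Phi R) u Phi_le Phi_continuous.
- by exists 0; have := Phi_opp 0; rewrite oppr0; lra.
- have [K K0 HK] := @central_prob_near1 (1 - u) ltac:(lra).
  exists K; have := HK K (lexx _); rewrite central_probE ?(ltW K0) //; lra.
exists z; split => //; rewrite ltNge; apply/negP => z0.
by have := Phi_le z0; have := Phi_opp 0; rewrite oppr0; lra.
Qed.

End NormalDistribution.

(** * Stein's identity for Bernoulli sums *)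

Section BernoulliStein.
Context {R : realType} {I : finType}.
Variables (p : I -> R) (s : R).
Hypothesis p01 : forall i, 0 <= p i <= 1.
Hypothesis s_gt0 : 0 < s.
Hypothesis s_var : s ^+ 2 = variance_sum p.
Implicit Type b : {ffun I -> bool}.

Definition std_sum b : R := centered_sum p b / s.

Lemma std_sum_upd b i :
  std_sum (upd b i true) - std_sum (upd b i false) = s^-1.
Proof. by rewrite -mulrBl centered_sum_upd mul1r. Qed.

Lemma std_sum_near b i c t :
  std_sum (upd b i false) <= t <= std_sum (upd b i true) ->
  `|std_sum (upd b i c) - t| <= s^-1.
Proof.
move=> /andP[t0 t1]; have := std_sum_upd b i; rewrite ler_norml.
by case: c => e; apply/andP; split; lra.
Qed.

Lemma variance_summand_ge0 i : 0 <= p i * (1 - p i).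
Proof. by have /andP[p0 p1] := p01 i; rewrite mulr_ge0 ?subr_ge0. Qed.

(** Integration by parts turns [W * f W] into increments of [f] over an interval of
    length [s^-1] around [W], hence into [df W] up to the oscillation of [df]. *)
Lemma stein_bernoulli (f df : R -> R) (C : R) :
  (forall x, is_derive x (1 : R) f (df x)) ->
  (forall x y, `|df x - df y| <= C * `|x - y|) ->
  `|bexp p (fun b => df (std_sum b) - std_sum b * f (std_sum b))| <= C / s.
Proof.
move=> fdf dflip.
have C0 : 0 <= C by have := le_trans (normr_ge0 _) (dflip 1 0); rewrite subr0 normr1 mulr1.
have -> : bexp p (fun b => df (std_sum b) - std_sum b * f (std_sum b)) =
  \sum_i p i * (1 - p i) / s * bexp p (fun b => df (std_sum b) / s -
     (f (std_sum (upd b i true)) - f (std_sum (upd b i false)))).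
  under [RHS]eq_bigr do rewrite bexpB mulrBr.
  rewrite sumrB bexpB; congr (_ - _).
    have -> : bexp p (fun b => df (std_sum b) / s) = bexp p (fun b => df (std_sum b)) / s.
      by rewrite mulrC -bexpZ; apply: eq_bexp => b; rewrite mulrC.
    rewrite -!mulr_suml -/(variance_sum p) -s_var; field; exact: lt0r_neq0.
  rewrite (eq_bexp _ (g := fun b => s^-1 * (centered_sum p b * f (std_sum b)))).
    rewrite bexpZ bexp_centered_sum_mul mulr_sumr; apply: eq_bigr => i _.
    by rewrite mulrA; congr (_ * _); rewrite mulrC.
  by move=> b; rewrite mulrA; congr (_ * _); rewrite mulrC.
apply: (le_trans (ler_norm_sum _ _ _)).
have -> : C / s = \sum_i p i * (1 - p i) / s * (C / s ^+ 2).
  rewrite -!mulr_suml -/(variance_sum p) -s_var; field; exact: lt0r_neq0.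
apply: ler_sum => i _; rewrite normrM ger0_norm; last first.
  by rewrite mulr_ge0 ?variance_summand_ge0 // invr_ge0 ltW.
rewrite ler_wpM2l //.
  by rewrite mulr_ge0 ?variance_summand_ge0 // invr_ge0 ltW.
apply: bexp_abs_le => // b.
have le01 : std_sum (upd b i false) <= std_sum (upd b i true).
  by rewrite -subr_ge0 std_sum_upd invr_ge0 ltW.
have [|t] := @MVT_segment _ f df _ _ le01 (fun x _ => fdf x).
  apply: continuous_subspaceT => z; have [dz _] := fdf z.
  by apply: differentiable_continuous; exact/derivable1_diffP.
rewrite in_itv /= => tb ->; rewrite std_sum_upd -mulrBl normrM.
rewrite [`|s^-1|]ger0_norm ?invr_ge0 ?(ltW s_gt0) // expr2 invfM mulrA.
rewrite ler_wpM2r ?invr_ge0 ?(ltW s_gt0) // (le_trans (dflip _ _)) // ler_wpM2l //.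
by rewrite -[in X in std_sum X](upd_id b i) std_sum_near.
Qed.

Lemma bexp_std_sum2 : bexp p (fun b => std_sum b ^+ 2) = 1.
Proof.
rewrite (eq_bexp _ (g := fun b => s^-2 * centered_sum p b ^+ 2)); last first.
  by move=> b; rewrite expr_div_n mulrC.
by rewrite bexpZ bexp_centered_sum2 -s_var mulVf // expf_neq0 // lt0r_neq0.
Qed.

End BernoulliStein.

(** * Trapezoidal test functions *)

Section Trapezoid.
Context {R : realType}.
Implicit Types a b x y : R.

(** Equal to 1 on [- a, a], to 0 outside [- b, b] and affine in between, hence squeezed
    between the indicators of the two intervals. *)
Definition trapezoid a b x : R := Num.max 0 (Num.min 1 ((b - `|x|) / (b - a))).

Lemma trapezoid_ge0 a b x : 0 <= trapezoid a b x.
Proof. by rewrite le_max lexx. Qed.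

Lemma trapezoid_le1 a b x : trapezoid a b x <= 1.
Proof. by rewrite ge_max ler01 ge_min lexx. Qed.

Lemma trapezoid_norm_le1 a b x : `|trapezoid a b x| <= 1.
Proof. by rewrite ger0_norm ?trapezoid_ge0 ?trapezoid_le1. Qed.

Lemma trapezoid_in a b x : a < b -> `|x| <= a -> trapezoid a b x = 1.
Proof.
move=> ab xa; rewrite /trapezoid (min_idPl _) ?(max_idPr _) //.
by rewrite ler_pdivlMr ?subr_gt0 // mul1r lerB.
Qed.

Lemma trapezoid_out a b x : a < b -> b <= `|x| -> trapezoid a b x = 0.
Proof.
move=> ab bx; apply/max_idPl; rewrite ge_min; apply/orP; right.
by rewrite mulr_le0_ge0 ?subr_le0 ?invr_ge0 ?subr_ge0 // ltW.
Qed.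

Lemma trapezoid_lipschitz a b x y : a < b ->
  `|trapezoid a b x - trapezoid a b y| <= (b - a)^-1 * `|x - y|.
Proof.
move=> ab; have i0 : 0 <= (b - a)^-1 by rewrite invr_ge0 subr_ge0 ltW.
apply: (@le_trans _ _ `|(b - `|x|) / (b - a) - (b - `|y|) / (b - a)|); last first.
  rewrite -mulrBl normrM mulrC (ger0_norm i0) ler_wpM2l //.
  by rewrite opprB addrC addrA subrK distrC ler_dist_dist.
rewrite /trapezoid; move: (_ / _) (_ / _) => u v.
have := ler_norm (v - u); have := ler_norm (- (v - u)); rewrite normrN.
rewrite ler_norml; case: (leP 1 u) => ?; case: (leP 1 v) => ?; case: (leP 0 (1 : R)) => ?;
  case: (leP 0 u) => ?; case: (leP 0 v) => ? *; apply/andP; split; lra.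
Qed.

Lemma trapezoid_measurable a b : a < b -> measurable_fun setT (trapezoid a b).
Proof.
move=> ab; apply: continuous_measurable_fun.
by apply: (@lipschitz_fun_continuous _ _ (b - a)^-1) => x y; exact: trapezoid_lipschitz.
Qed.

Lemma central_prob_le_trapezoid a b : a < b ->
  central_prob a <= gauss_mean (trapezoid a b).
Proof.
move=> ab; rewrite /central_prob -gauss_mean_indic //.
apply: (@ler_gauss_mean _ _ _ 1) => //.
- exact: trapezoid_measurable.
- by move=> x; rewrite indicE; case: (_ \in _); rewrite ?normr1 ?normr0.
- exact: trapezoid_norm_le1.
move=> x; rewrite indicE; case: (boolP (x \in _)); rewrite ?trapezoid_ge0 //.
rewrite inE /= in_itv /= -ler_norml => xa.
by rewrite trapezoid_in.
Qed.

Lemma gauss_mean_trapezoid_le a b : a < b ->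
  gauss_mean (trapezoid a b) <= central_prob b.
Proof.
move=> ab; rewrite /central_prob -gauss_mean_indic //.
apply: (@ler_gauss_mean _ _ _ 1) => //.
- exact: trapezoid_measurable.
- exact: trapezoid_norm_le1.
- by move=> x; rewrite indicE; case: (_ \in _); rewrite ?normr1 ?normr0.
move=> x; rewrite indicE; case: (boolP (x \in _)); rewrite ?trapezoid_le1 //.
rewrite notin_setE /= in_itv /= -ler_norml => /negP; rewrite -ltNge => xb.
by rewrite trapezoid_out // ltW.
Qed.

End Trapezoid.

(** * The central limit theorem for Bernoulli sums *)

Section CentralLimit.
Context {R : realType}.

(** The multiple of the wide plateau [trapezoid K (K + 1)] makes the test function
    have Gaussian mean [0], so that the Stein solution has compact support;
    Chebyshev bounds the mass that [W] puts outside the plateau. *)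
Lemma clt_trapezoid (a b e : R) : 0 <= a -> a < b -> 0 < e ->
  exists2 s0 : R, 0 < s0 & forall (I : finType) (p : I -> R) (s : R),
    (forall i, 0 <= p i <= 1) -> s ^+ 2 = variance_sum p -> s0 <= s ->
    central_prob a - e <= bexp p (fun x => trapezoid a b (std_sum p s x))
      <= central_prob b + e.
Proof.
move=> a0 ab e0; have b0 : 0 < b := le_lt_trans a0 ab.
have d0 : 0 < (e / 2) / (1 + e / 2) by rewrite divr_gt0 ?addr_gt0 ?divr_gt0.
have [K0 K00 HK0] := @central_prob_near1 R _ d0.
(* The plateau must contain the support of [h], carry Gaussian mass at least
   [(1 + e / 2)^-1], and miss [W] with probability at most [K ^- 2 <= e / 2]. *)
pose K := Num.max (Num.max K0 b) (1 + 2 / e).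
have K_K0 : K0 <= K by rewrite !le_max lexx.
have K_b : b <= K by rewrite !le_max lexx orbT.
have K_e : 1 + 2 / e <= K by rewrite le_max lexx orbT.
have K_gt0 : 0 < K by rewrite (lt_le_trans b0).
have KK1 : K < K + 1 by rewrite ltrDl.
pose h := trapezoid a b; pose chi := trapezoid K (K + 1).
pose m := gauss_mean h; pose k := gauss_mean chi.
have k_lb : (1 + e / 2)^-1 <= k.
  apply: le_trans (central_prob_le_trapezoid KK1); apply: le_trans (HK0 _ K_K0).
  rewrite le_eqVlt; apply/orP; left; apply/eqP; field.
  by rewrite gt_eqF // addr_gt0.
have k_gt0 : 0 < k by rewrite (lt_le_trans _ k_lb) // invr_gt0 addr_gt0 ?divr_gt0.
have k_le1 : k <= 1.
  exact: le_trans (gauss_mean_trapezoid_le KK1) (central_prob_le1 _).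
have m_lb : central_prob a <= m := central_prob_le_trapezoid ab.
have m_ub : m <= central_prob b := gauss_mean_trapezoid_le ab.
have m_ge0 : 0 <= m := le_trans (central_prob_ge0 _) m_lb.
have m_le1 : m <= 1 := le_trans m_ub (central_prob_le1 _).
(* This multiple of [chi] cancels the Gaussian mean of [h]. *)
pose c := m / k.
have c_ge0 : 0 <= c by rewrite divr_ge0 // ltW.
have c_lb : m <= c by rewrite ler_pdivlMr // ler_piMr.
have c_ub : c <= m + e / 2.
  rewrite ler_pdivrMr //; have : (1 + e / 2) * (1 + e / 2)^-1 <= (1 + e / 2) * k.
    by rewrite ler_wpM2l // addr_ge0 // divr_ge0 ?ltW.
  rewrite mulfV ?gt_eqF ?addr_gt0 ?divr_gt0 // => k1.
  have : m * 1 <= m * ((1 + e / 2) * k) by rewrite ler_wpM2l.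
  have : 0 <= (1 - m) * (e / 2 * k) by rewrite !mulr_ge0 ?subr_ge0 // ?ltW.
  nra.
pose g x := h x - c * chi x.
have g_lip x y : `|g x - g y| <= ((b - a)^-1 + c) * `|x - y|.
  rewrite (_ : g x - g y = (h x - h y) - c * (chi x - chi y)); last by rewrite /g; ring.
  rewrite (le_trans (ler_normB _ _)) // mulrDl lerD ?trapezoid_lipschitz //.
  rewrite normrM (ger0_norm c_ge0) ler_wpM2l // (le_trans (trapezoid_lipschitz _ _ KK1)) //.
  by rewrite addrAC subrr add0r invr1 mul1r.
have g_bound x : `|g x| <= 1 + c.
  rewrite (le_trans (ler_normB _ _)) // lerD ?trapezoid_norm_le1 //.
  by rewrite normrM (ger0_norm c_ge0) ler_piMr ?trapezoid_norm_le1.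
have g_supp x : K + 1 <= `|x| -> g x = 0.
  move=> Kx; rewrite /g /h /chi !trapezoid_out ?mulr0 ?subrr //.
  by rewrite (le_trans _ Kx) // (le_trans K_b) // ltW.
have g_mean0 : gauss_mean g = 0.
  rewrite (@gauss_meanB _ h chi 1 c (trapezoid_measurable ab)
    (trapezoid_measurable KK1) (trapezoid_norm_le1 a b) (trapezoid_norm_le1 _ _)).
  by rewrite -/m -/k divfK ?subrr // gt_eqF.
have K1_gt0 : 0 < K + 1 by rewrite addr_gt0.
pose C := stein_const ((b - a)^-1 + c) (1 + c) (K + 1).
have C_ge0 : 0 <= C.
  have := stein_solution_derive_lipschitz K1_gt0 g_lip g_bound g_supp g_mean0 1 0.
  by move=> /(le_trans (normr_ge0 _)); rewrite subr0 normr1 mulr1.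
exists (1 + 2 * C / e).
  by rewrite ltr_wpDr // divr_ge0 ?mulr_ge0 // ltW.
move=> I p s p01 s_var s0s.
have s_gt0 : 0 < s by apply: lt_le_trans s0s; rewrite ltr_wpDr // divr_ge0 ?mulr_ge0 // ltW.
have Eg : `|bexp p (fun x => g (std_sum p s x))| <= e / 2.
  rewrite (eq_bexp _ (g := fun x =>
    (std_sum p s x * stein_solution g (std_sum p s x) + g (std_sum p s x))
     - std_sum p s x * stein_solution g (std_sum p s x))); last first.
    by move=> x; rewrite addrAC subrr add0r.
  apply: (le_trans (stein_bernoulli p01 s_gt0 s_var
     (is_derive_stein_solution g_lip g_bound)
     (stein_solution_derive_lipschitz K1_gt0 g_lip g_bound g_supp g_mean0))).
  rewrite -/C ler_pdivrMr //.
  have : e / 2 * (1 + 2 * C / e) <= e / 2 * s by rewrite ler_wpM2l // divr_ge0 // ltW.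
  apply: le_trans.
  rewrite (_ : _ * _ = e / 2 + C); last by field; rewrite gt_eqF.
  by rewrite lerDr divr_ge0 // ltW.
have Echi1 : bexp p (fun x => chi (std_sum p s x)) <= 1.
  by rewrite -[leRHS](bexp_cst p); apply: ler_bexp => // x; exact: trapezoid_le1.
have Echi : 1 - e / 2 <= bexp p (fun x => chi (std_sum p s x)).
  have := bexp_chebyshev p01 (std_sum p s) K_gt0.
  rewrite bexp_std_sum2 // => cheb.
  apply: (@le_trans _ _ (1 - bexp p (fun x => (K < `|std_sum p s x|)%R%:R))); last first.
    rewrite -[X in X - _](bexp_cst p) -bexpB; apply: ler_bexp => // x.
    case: ltP => xK; first by rewrite subrr trapezoid_ge0.
    by rewrite subr0 /chi trapezoid_in.
  rewrite lerD2l lerN2 (le_trans cheb) // ler_pdivrMr ?exprn_gt0 //.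
  have K2 : (1 + 2 / e) * 1 <= K * K.
    rewrite ler_pM ?addr_ge0 ?divr_ge0 ?(ltW e0) //.
    by rewrite (le_trans _ K_e) // lerDl divr_ge0 // ltW.
  have : e / 2 * ((1 + 2 / e) * 1) <= e / 2 * (K * K) by rewrite ler_wpM2l // divr_ge0 // ltW.
  rewrite expr2; apply: le_trans.
  rewrite (_ : _ * _ = e / 2 + 1); last by field; rewrite gt_eqF.
  by rewrite lerDr divr_ge0 // ltW.
have -> : bexp p (fun x => trapezoid a b (std_sum p s x)) =
   bexp p (fun x => g (std_sum p s x)) + c * bexp p (fun x => chi (std_sum p s x)).
  by rewrite -bexpZ -bexpD; apply: eq_bexp => x; rewrite /g subrK.
move: Eg; rewrite ler_norml => /andP[Eg1 Eg2].
set E := bexp p (fun x => chi _) in Echi Echi1 *.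
have : c * E <= c * 1 by rewrite ler_wpM2l.
have : m * (1 - e / 2) <= c * E.
  apply: (le_trans (y := m * E)); first by rewrite ler_wpM2l.
  rewrite ler_wpM2r //.
  by apply: bexp_ge0 => // x; exact: trapezoid_ge0.
have : m * (e / 2) <= 1 * (e / 2) by rewrite ler_wpM2r // divr_ge0 // ltW.
by move=> *; apply/andP; split; lra.
Qed.

End CentralLimit.

(** * Events determined by finitely many indicators *)

Section FiniteValued.
Context d (T : measurableType d) (R : realType) (P : probability T R).

(** Such an event is a finite disjoint union of fibres. *)
Lemma measure_finite_range (V : eqType) (f : T -> V) (r : seq V) : uniq r ->
  (forall v, measurable [set w | f w = v]) ->
  measurable [set w | f w \in r] /\
  P [set w | f w \in r] = (\sum_(v <- r) P [set w | f w = v])%E.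
Proof.
move=> + mf; elim: r => [_|v r IH /= /andP[vr /IH[mr Pr]]].
  rewrite big_nil (_ : [set w | _] = set0) ?measure0; first by split.
  by apply/seteqP; split.
have -> : [set w | f w \in v :: r] = [set w | f w = v] `|` [set w | f w \in r].
  apply/seteqP; split => w /=; rewrite inE; first by case/orP => [/eqP|]; [left|right].
  by case=> [->|->]; rewrite ?eqxx ?orbT.
split; first exact: measurableU.
rewrite big_cons -Pr; apply: measureU => //.
by apply/seteqP; split => w //= [->]; exact/negP.
Qed.

Context (K : finType) (f : K -> T -> bool).
Hypothesis mf : forall k, measurable [set w | f k w].

Lemma ffun_fiber (b : {ffun K -> bool}) :
  [set w | [ffun k => f k w] = b] =
  \bigcap_(k in [set: K]) (if b k then [set w | f k w] else ~` [set w | f k w]).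
Proof.
apply/seteqP; split => w /=.
  by move=> /ffunP e k _; have := e k; rewrite ffunE => <-; case: ifPn => // /negP.
move=> H; apply/ffunP => k; rewrite ffunE.
by have := H k I; case: ifPn => //= _ /negP/negbTE.
Qed.

Lemma measurable_ffun_fiber (b : {ffun K -> bool}) :
  measurable [set w | [ffun k => f k w] = b].
Proof.
rewrite ffun_fiber; apply: fin_bigcap_measurable => [|k _].
  exact: finite_finset.
by case: ifP => // _; exact: measurableC.
Qed.

Lemma measurable_ffun_event (Q : pred {ffun K -> bool}) :
  measurable [set w | Q [ffun k => f k w]].
Proof.
have [+ _] := measure_finite_range (enum_uniq Q) measurable_ffun_fiber.
by under eq_set do rewrite mem_enum.
Qed.

Lemma measure_ffun_event (Q : pred {ffun K -> bool}) :
  P [set w | Q [ffun k => f k w]] =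
  (\sum_(b | Q b) P [set w | [ffun k => f k w] = b])%E.
Proof.
have [_] := measure_finite_range (enum_uniq Q) measurable_ffun_fiber.
by rewrite big_enum; under eq_set do rewrite mem_enum.
Qed.

End FiniteValued.

(** * The indicators of the observations below a point *)

Section SampleLaw.
Context d (T : measurableType d) (R : realType) (P : probability T R).
Variables (n : nat) (X : 'I_n -> {RV P >-> R}).
Hypothesis indepX : independent_RVs X.
Implicit Types (x : R) (w : T).

Definition below x w : {ffun 'I_n -> bool} := [ffun i => X i w <= x].

Lemma measurable_RV_preimage i (B : set R) : measurable B -> measurable (X i @^-1` B).
Proof. by move=> mB; rewrite -[X in measurable X]setTI; exact: measurable_funP. Qed.

Lemma measurable_RV_le i x : measurable [set w | X i w <= x].
Proof.
have := measurable_RV_preimage i (measurable_itv `]-oo, x]).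
by congr measurable; apply/seteqP; split => w /=; rewrite in_itv.
Qed.

Lemma dfunE i x : P (X i @^-1` `]-oo, x]) = (dfun X i x)%:E.
Proof. by rewrite /dfun fineK // fin_num_measure // ; exact: measurable_RV_preimage. Qed.

Lemma dfun01 i x : 0 <= dfun X i x <= 1.
Proof.
rewrite -!lee_fin -dfunE measure_ge0 /=.
by apply: probability_le1; exact: measurable_RV_preimage.
Qed.

Lemma dfun_le i x y : x <= y -> dfun X i x <= dfun X i y.
Proof.
move=> xy; rewrite fine_le ?fin_num_measure //; try exact: measurable_RV_preimage.
exact: cdf_nondecreasing.
Qed.

(** The product rule for the family of sets equal, coordinate by coordinate, to a
    half-line or to its complement. *)
Lemma below_fiber_law x (b : {ffun 'I_n -> bool}) :
  P [set w | below x w = b] = (bernoulli_weight (fun i => dfun X i x) b)%:E.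
Proof.
pose B i : set R := if b i then `]-oo, x]%classic else ~` `]-oo, x].
have mB i : measurable (B i) by rewrite /B; case: ifP => // _; exact: measurableC.
rewrite /below ffun_fiber.
transitivity (P (\bigcap_(i in [set` [set: 'I_n]%SET]) X i @^-1` B i)).
  congr (P _); apply/seteqP; split => w /= H i Hi.
    have := H i I; rewrite /B; case: (b i) => /=; first by rewrite in_itv.
    by rewrite in_itv.
  have := H i (finset.in_setT i); rewrite /B; case: (b i) => /=; first by rewrite in_itv.
  by rewrite in_itv.
rewrite indepX // /bernoulli_weight -prodEFin; apply: eq_big => [i|i _].
  by rewrite finset.in_setT.
rewrite /B; case: (b i); first exact: dfunE.
rewrite preimage_setC probability_setC ?dfunE //.
exact: (measurable_RV_preimage i (measurable_itv `]-oo, x])).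
Qed.

Lemma measurable_below_event x (Q : pred {ffun 'I_n -> bool}) :
  measurable [set w | Q (below x w)].
Proof. by apply: (measurable_ffun_event P) => i; exact: measurable_RV_le. Qed.

Lemma below_event_law x (Q : pred {ffun 'I_n -> bool}) :
  P [set w | Q (below x w)] = (bexp (fun i => dfun X i x) (fun b => (Q b)%:R))%:E.
Proof.
rewrite /below measure_ffun_event; last by move=> i; exact: measurable_RV_le.
under eq_bigr do rewrite -/(below x _) below_fiber_law.
rewrite sumEFin; congr EFin; rewrite big_mkcond; apply: eq_bigr => b _.
by case: (Q b); rewrite ?mulr1 ?mulr0.
Qed.

End SampleLaw.

(** * The empirical quantile function *)

Section EmpiricalQuantile.
Context d (T : measurableType d) (R : realType) (P : probability T R).
Variables (n : nat) (X : 'I_n -> {RV P >-> R}).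
Implicit Types (x p : R) (w : T).

(** The left limit of the empirical distribution function. *)
Definition empirical_left_dfun w x : R := n%:R^-1 * \sum_(i < n) (X i w < x)%R%:R.

Lemma empirical_dfun_le w : {homo empirical_dfun X w : x y / x <= y}.
Proof.
move=> x y xy; rewrite ler_wpM2l ?invr_ge0 //; apply: ler_sum => i _.
by rewrite ler_nat; case: (leP (X i w) x) => //= Xx; rewrite (le_trans Xx xy).
Qed.

(** The empirical distribution function is constant on some interval to the right
    of [x]. *)
Lemma right_gap w x : exists2 y, x < y & forall i, X i w <= y -> X i w <= x.
Proof.
have near_gap : \forall y \near x^'+, forall i, X i w <= y -> X i w <= x.
  apply: filter_forall => i; have [Xx|xX] := leP (X i w) x; first by near=> y.
  near=> y; rewrite leNgt; have -> : y < X i w by near: y; exact: nbhs_right_lt.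
  by [].
near x^'+ => y; exists y; first by near: y; exact: nbhs_right_gt.
by near: y.
Unshelve. all: by end_near. Qed.

Lemma left_gap w x : exists2 y, y < x & forall i, X i w < x -> X i w <= y.
Proof.
have near_gap : \forall y \near x^'-, forall i, X i w < x -> X i w <= y.
  apply: filter_forall => i; have [Xx|xX] := ltP (X i w) x; last by near=> y.
  by near=> y => _; near: y; exact: nbhs_left_ge.
near x^'- => y; exists y; first by near: y; exact: nbhs_left_lt.
by near: y.
Unshelve. all: by end_near. Qed.

Lemma empirical_quantile_le w p x :
  (empirical_quantile X w p <= x%:E)%E = (p <= empirical_dfun X w x).
Proof.
apply: quantile_le => [y z yz|Fxp]; first exact: empirical_dfun_le.
have [y xy gap] := right_gap w x; exists y => //.
apply: le_lt_trans Fxp; rewrite ler_wpM2l ?invr_ge0 //.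
apply: ler_sum => i _; rewrite ler_nat.
by case: (leP (X i w) y) => // /gap ->.
Qed.

Lemma empirical_quantile_lt w p x :
  (empirical_quantile X w p < x%:E)%E = (p <= empirical_left_dfun w x).
Proof.
apply/idP/idP => [/quantile_lt[y yx pFy]|pF].
  apply: (le_trans pFy); rewrite ler_wpM2l ?invr_ge0 //; apply: ler_sum => i _.
  by rewrite ler_nat; case: (leP (X i w) y) => //= Xy; rewrite (le_lt_trans Xy yx).
have [y yx gap] := left_gap w x; apply/quantile_lt; exists y => //.
apply: (le_trans pF); rewrite ler_wpM2l ?invr_ge0 //; apply: ler_sum => i _.
by rewrite ler_nat; case: (ltP (X i w) x) => // /gap ->.
Qed.

Lemma empirical_left_dfun_le w x : empirical_left_dfun w x <= empirical_dfun X w x.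
Proof.
rewrite ler_wpM2l ?invr_ge0 //; apply: ler_sum => i _.
by rewrite ler_nat; case: (ltP (X i w) x) => // /ltW ->.
Qed.

Lemma empirical_left_dfun_eq w x : (forall i, X i w != x) ->
  empirical_left_dfun w x = empirical_dfun X w x.
Proof.
by move=> Xx; congr (_ * _); apply: eq_bigr => i _; rewrite lt_neqAle Xx.
Qed.

Definition below_quantile p w : {ffun 'I_n -> bool} :=
  [ffun i => ((X i w)%:E <= empirical_quantile X w p)%E].

(** Whether [X i] is at most the empirical quantile depends only on the number of
    observations strictly smaller than [X i]; measurability follows from this. *)
Lemma below_quantileE p w i :
  below_quantile p w i = (empirical_left_dfun w (X i w) < p).
Proof. by rewrite ffunE leNgt empirical_quantile_lt -ltNge. Qed.

Lemma measurable_RV_lt i x : measurable [set w | X i w < x].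
Proof.
have := measurable_RV_preimage X i (measurable_itv `]-oo, x[).
by congr measurable; apply/seteqP; split => w /=; rewrite in_itv.
Qed.

Lemma measurable_RV_eq i x : measurable [set w | X i w = x].
Proof. by have := measurable_RV_preimage X i (measurable_set1 x). Qed.

Lemma measurable_RV_lt2 i k : measurable [set w | X k w < X i w].
Proof.
have -> : [set w | X k w < X i w] = (fun w => X i w - X k w) @^-1` `]0, +oo[.
  by apply/seteqP; split => w /=; rewrite in_itv /= andbT subr_gt0.
rewrite -[X in measurable X]setTI.
have mB : measurable_fun setT (fun w => X i w - X k w) by exact: measurable_funB.
by apply: mB => //; exact: measurable_itv.
Qed.

Lemma measurable_below_quantile p i : measurable [set w | below_quantile p w i].
Proof.
pose Q (b : {ffun 'I_n -> bool}) := n%:R^-1 * \sum_(k < n) (b k)%:R < p.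
have := @measurable_ffun_event _ _ _ P _ (fun k w => X k w < X i w)
  (measurable_RV_lt2 i) Q.
congr measurable; apply/seteqP; split => w /=; rewrite below_quantileE /Q;
  by under eq_bigr do rewrite ffunE.
Qed.

End EmpiricalQuantile.

(** * Weights attached to a partition *)

Section BlockWeights.
Context {R : realFieldType} {n : nat}.
Variable I : {set {set 'I_n}}.
Hypothesis partI : finset.partition I [set: 'I_n]%SET.
Hypothesis cardI : forall A : {set 'I_n}, A \in I -> (2 <= #|A|)%N.
Implicit Types i j : 'I_n.

Let block i := finset.pblock I i.

(** The diagonal is set to 0 since [b i && ~~ b i] is false; the weights of a row then
    sum to 1. *)
Definition block_weight i j : R :=
  if (j != i) && (j \in block i) then (#|block i|%:R - 1)^-1 else 0.

Let block_in i : block i \in I.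
Proof.
case/and3P: partI => /eqP cov _ _; apply: finset.pblock_mem.
by rewrite cov finset.in_setT.
Qed.

Let mem_block i : i \in block i.
Proof.
case/and3P: partI => /eqP cov _ _.
by rewrite finset.mem_pblock cov finset.in_setT.
Qed.

Let block_eq A i : A \in I -> i \in A -> block i = A.
Proof. by case/and3P: partI => _ tI _; exact: finset.def_pblock. Qed.

Let block_gt1 i : 0 < #|block i|%:R - 1 :> R.
Proof. by rewrite subr_gt0 ltr1n cardI. Qed.

Lemma block_weight_ge0 i j : 0 <= block_weight i j.
Proof. by rewrite /block_weight; case: ifP => // _; rewrite invr_ge0 ltW. Qed.

Lemma block_weight_diag i : block_weight i i = 0.
Proof. by rewrite /block_weight eqxx. Qed.

Lemma block_weight_sym i j : block_weight i j = block_weight j i.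
Proof.
rewrite /block_weight eq_sym; case: eqP => //= _.
have [ji|ji] := boolP (j \in block i).
  by rewrite (block_eq (block_in i) ji) mem_block.
case: ifPn => // ij; move: ji.
by rewrite (block_eq (block_in j) ij) mem_block.
Qed.

Lemma block_weight_row i : \sum_j block_weight i j = 1.
Proof.
rewrite /block_weight -big_mkcond /= sumr_const.
rewrite (_ : #|_| = #|block i|.-1)%N; last first.
  rewrite [#|block i|](cardD1 i) mem_block /=.
  by apply: eq_card => j; rewrite !inE.
rewrite -[X in X *+ _]mulr1 -mulrnAr -subn1 natrB; last exact: ltnW (cardI (block_in i)).
by rewrite mulVf // gt_eqF.
Qed.

Lemma block_weight_supp i j : block_weight i j != 0 ->
  exists2 A, A \in I & (i \in A) && (j \in A).
Proof.
rewrite /block_weight; case: ifPn => [/andP[_ ji] _|]; last by rewrite eqxx.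
by exists (block i) => //; rewrite mem_block.
Qed.

Lemma sum_blocks (b : {ffun 'I_n -> bool}) :
  \sum_(A in I) (#|A|%:R - 1)^-1 *
    (\sum_(i in A) \sum_(j in A) (b i && ~~ b j)%:R) =
  pair_statistic block_weight b.
Proof.
rewrite /pair_statistic.
rewrite -[RHS](eq_bigl _ _ (fun i => finset.in_setT i)).
rewrite (finset.set_partition_big _ partI) /=; apply: eq_bigr => A AI.
rewrite mulr_sumr; apply: eq_bigr => i iA.
rewrite mulr_sumr big_mkcond; apply: eq_bigr => j _.
rewrite /block_weight (block_eq AI iA).
have [->|ji] /= := eqVneq j i.
  by rewrite iA andbN mulr0 mul0r.
case: (j \in A); last by rewrite mul0r.
by case: (b i) (b j) => [] []; rewrite /= ?(subrr, subr0, mulr0, mul0r, mulr1).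
Qed.

End BlockWeights.

(** * The mean distribution function *)

Section MeanQuantile.
Context d (T : measurableType d) (R : realType) (P : probability T R).
Variables (n : nat) (X : 'I_n -> {RV P >-> R}).
Hypothesis n_gt0 : (0 < n)%N.
Hypothesis cont_mean : continuous (mean_dfun X).

Let nR_gt0 : 0 < n%:R :> R.
Proof. by rewrite ltr0n. Qed.

Lemma mean_dfun_le : {homo mean_dfun X : x y / x <= y}.
Proof.
move=> x y xy; rewrite ler_wpM2l ?invr_ge0 //.
by apply: ler_sum => i _; exact: dfun_le.
Qed.

Lemma sum_dfun x : \sum_(i < n) dfun X i x = n%:R * mean_dfun X x.
Proof. by rewrite /mean_dfun mulrA mulfV ?mul1r // gt_eqF. Qed.

Lemma mean_dfun_lt p : 0 < p -> exists x, mean_dfun X x < p.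
Proof.
move=> p0.
have near_small : \forall x \near -oo, forall i, dfun X i x < p.
  apply: filter_forall => i.
  by have /fine_cvgP[_ /cvgr_lt] := cvg_cdfNy0 (X i); exact.
have [x Hx] := filter_ex near_small; exists x.
rewrite /mean_dfun ltr_pdivrMl // mulr_natl -[X in _ < _ *+ X]card_ord -sumr_const.
apply: ltr_sum => //.
by apply/hasP; exists (Ordinal n_gt0) => //; rewrite mem_index_enum.
Qed.

Lemma mean_dfun_gt p : p < 1 -> exists x, p < mean_dfun X x.
Proof.
move=> p1.
have near_large : \forall x \near +oo, forall i, p < dfun X i x.
  apply: filter_forall => i.
  by have /fine_cvgP[_ /cvgr_gt] := cvg_cdfy1 (X i); exact.
have [x Hx] := filter_ex near_large; exists x.
rewrite /mean_dfun ltr_pdivlMl // mulr_natl -[X in _ *+ X < _]card_ord -sumr_const.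
apply: ltr_sum => //.
by apply/hasP; exists (Ordinal n_gt0) => //; rewrite mem_index_enum.
Qed.

Lemma mean_quantileE p : 0 < p < 1 ->
  exists2 q, mean_quantile X p = q%:E & mean_dfun X q = p.
Proof.
case/andP=> p0 p1; apply: quantile_continuous => //.
- exact: mean_dfun_le.
- exact: mean_dfun_lt.
- exact: mean_dfun_gt.
Qed.

(** A jump of one distribution function at [q] would be a jump of their mean. *)
Lemma no_atom i q : P [set w | X i w = q] = 0%E.
Proof.
have mN : measurable [set w | X i w = q] := measurable_RV_eq X i q.
have Pfin : P [set w | X i w = q] \is a fin_num by exact: fin_num_measure.
apply/eqP; rewrite eq_le measure_ge0 andbT -(fineK Pfin) lee_fin.
apply/ler_addgt0Pr => e e0; rewrite add0r.
have near_q : \forall y \near q, mean_dfun X q - e / n%:R < mean_dfun X y.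
  apply: (cvgr_gt (mean_dfun X q) (cont_mean (x := q))).
  by rewrite ltrBlDr ltrDl divr_gt0.
have [y yq Fy] : exists2 y, y < q & mean_dfun X q - e / n%:R < mean_dfun X y.
  have [r /= r0 Hr] := (nbhs_ballP _ _).1 near_q.
  exists (q - r / 2); first by rewrite ltrBlDr ltrDl divr_gt0.
  apply: Hr; rewrite /ball /= opprB addrCA subrr addr0 gtr0_norm ?divr_gt0 //.
  by rewrite ltr_pdivrMr // ltr_pMr // ltr1n.
have mB z : measurable (X i @^-1` `]-oo, z]).
  by apply: measurable_RV_preimage; exact: measurable_itv.
have le_jump : (P [set w | X i w = q] + P (X i @^-1` `]-oo, y])
    <= P (X i @^-1` `]-oo, q]))%E.
  rewrite -measureU //.
    apply: le_measure; rewrite ?inE //; first exact: measurableU.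
    move=> w [/= ->|] /=; rewrite !in_itv /= ?lexx // => Xy.
    by rewrite (le_trans Xy) // ltW.
  by apply/seteqP; split => w //= [->]; rewrite in_itv /= leNgt yq.
rewrite !dfunE -(fineK Pfin) -EFinD lee_fin in le_jump.
have jump_le : dfun X i q - dfun X i y <= n%:R * (mean_dfun X q - mean_dfun X y).
  rewrite mulrBr -!sum_dfun -sumrB (bigD1 i) //= lerDl.
  by apply: sumr_ge0 => k _; rewrite subr_ge0 dfun_le // ltW.
have : n%:R * (mean_dfun X q - mean_dfun X y) <= n%:R * (e / n%:R).
  by rewrite ler_wpM2l //; lra.
rewrite mulrCA mulfV ?gt_eqF // mulr1; lra.
Qed.

Lemma no_atoms q (r : seq 'I_n) :
  measurable [set w | has (fun i => X i w == q) r] /\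
  P [set w | has (fun i => X i w == q) r] = 0%E.
Proof.
elim: r => [|i r [mr Pr]]; first by rewrite /= set_false measure0; split.
have -> : [set w | has (fun i => X i w == q) (i :: r)] =
    [set w | X i w = q] `|` [set w | has (fun i => X i w == q) r].
  apply/seteqP; split => w /=; first by case/orP => [/eqP|]; [left|right].
  by case=> [->|->]; rewrite ?eqxx ?orbT.
have mi := measurable_RV_eq X i q; split; first exact: measurableU.
apply/eqP; rewrite eq_le measure_ge0 andbT.
have U2 : (P ([set w | X i w = q] `|` [set w | has (fun i => X i w == q) r]) <=
    P [set w | X i w = q] + P [set w | has (fun i => X i w == q) r])%E.
  exact: measureU2.
by apply: (le_trans U2); rewrite no_atom add0e Pr.
Qed.

End MeanQuantile.

(** * The coverage event *)

Section Coverage.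
Context d (T : measurableType d) (R : realType) (P : probability T R).
Variables (n : nat) (X : 'I_n -> {RV P >-> R}).
Hypothesis n_gt0 : (0 < n)%N.
Implicit Types (x : R) (w : T).

Let nR_gt0 : 0 < n%:R :> R.
Proof. by rewrite ltr0n. Qed.

Lemma sum_below x w : \sum_i (below X x w i)%:R = n%:R * empirical_dfun X w x.
Proof.
rewrite /empirical_dfun mulrA mulfV ?mul1r ?gt_eqF //.
by apply: eq_bigr => i _; rewrite ffunE.
Qed.

Lemma centered_sum_below x w :
  centered_sum (fun i => dfun X i x) (below X x w) =
  n%:R * (empirical_dfun X w x - mean_dfun X x).
Proof. by rewrite /centered_sum sumrB sum_below sum_dfun // mulrBr. Qed.

Lemma below_distance x y w : x <= y ->
  \sum_i `|(below X x w i)%:R - (below X y w i)%:R| =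
  n%:R * (empirical_dfun X w y - empirical_dfun X w x) :> R.
Proof.
move=> xy; rewrite mulrBr -!sum_below -sumrB; apply: eq_bigr => i _.
rewrite !ffunE distrC ger0_norm // subr_ge0 ler_nat.
by case: (leP (X i w) x) => //= Xx; rewrite (le_trans Xx xy).
Qed.

(** Few observations lie between the empirical quantile [Qhat] and [q]. If
    [Qhat <= q], there are at most [n * (Fhat q - tau)] of them, [Fhat] being the
    empirical distribution function. Otherwise there are at most
    [n * (Fhat q' - Fhat q)], because the deviation bound at [q'] forces
    [tau <= Fhat q'], that is [Qhat <= q']. *)
Lemma below_quantile_close (tau q q' t : R) w :
  0 < tau -> mean_dfun X q = tau -> mean_dfun X q' = tau + t / n%:R ->
  `|centered_sum (fun i => dfun X i q) (below X q w)| <= t ->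
  `|centered_sum (fun i => dfun X i q') (below X q' w)| <= t ->
  \sum_i `|(below_quantile X tau w i)%:R - (below X q w i)%:R| <= 3 * t.
Proof.
move=> tau0 Fq Fq'.
have nFq' : n%:R * (tau + t / n%:R) = n%:R * tau + t.
  by rewrite mulrDr mulrCA mulfV ?gt_eqF // mulr1.
rewrite !centered_sum_below Fq Fq' !ler_norml !mulrBr nFq'.
move=> /andP[S1 S2] /andP[S'1 S'2].
have t0 : 0 <= t by lra.
have Qhat_q' : (empirical_quantile X w tau <= q'%:E)%E.
  by rewrite empirical_quantile_le -(ler_pM2l nR_gt0); lra.
(* The empirical quantile is finite: as [tau > 0], it cannot lie to the left of all
   observations. *)
have [r Qr] : exists r, empirical_quantile X w tau = r%:E.
  case EQ : (empirical_quantile X w tau) => [r| |]; first by exists r.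
    by move: Qhat_q'; rewrite EQ.
  have near_small : \forall x \near -oo, forall i, x < X i w.
    by apply: filter_forall => i; exact: (nbhs_ninfty_lt (num_real _)).
  have [x Hx] := filter_ex near_small.
  have := empirical_quantile_le X w tau x; rewrite EQ leNye => /esym.
  rewrite /empirical_dfun big1 ?mulr0 ?leNgt ?tau0 // => i _.
  by rewrite leNgt Hx.
have Fr : tau <= empirical_dfun X w r by rewrite -empirical_quantile_le Qr.
have -> : below_quantile X tau w = below X r w.
  by apply/ffunP => i; rewrite !ffunE Qr lee_fin.
have [rq|qr] := leP r q.
  rewrite below_distance // mulrBr.
  have : n%:R * tau <= n%:R * empirical_dfun X w r by rewrite ler_wpM2l.
  lra.
have rq' : r <= q' by rewrite -lee_fin -Qr.
under eq_bigr do rewrite distrC.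
rewrite below_distance ?(ltW qr) // mulrBr.
have : n%:R * empirical_dfun X w r <= n%:R * empirical_dfun X w q'.
  by rewrite ler_wpM2l // empirical_dfun_le.
lra.
Qed.

Variable I : {set {set 'I_n}}.
Hypothesis partI : finset.partition I [set: 'I_n]%SET.

Lemma variance_estimatorE tau w :
  variance_estimator X I tau w =
  n%:R^-1 * pair_statistic (block_weight I) (below_quantile X tau w).
Proof.
rewrite -sum_blocks // /variance_estimator; congr (_ * _).
apply: eq_bigr => A _; congr (_ * _); apply: eq_bigr => i _; apply: eq_bigr => j _.
by rewrite !ffunE -ltNge.
Qed.

Definition z_quantile (alpha : R) : R := fine (quantile (@Phi R) (1 - alpha / 2)).

Lemma half_widthE tau alpha w :
  half_width X I tau alpha w =
  Num.sqrt (pair_statistic (block_weight I) (below_quantile X tau w))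
    * z_quantile alpha / n%:R.
Proof.
rewrite /half_width variance_estimatorE -/(z_quantile alpha).
set U := pair_statistic _ _.
have -> : n%:R^-1 * U / n%:R = n%:R^-1 ^+ 2 * U by ring.
rewrite sqrtrM ?sqr_ge0 // sqrtr_sqr ger0_norm ?invr_ge0 //; ring.
Qed.

Definition coverage_event tau alpha : set T :=
  [set w | (empirical_quantile X w (tau - half_width X I tau alpha w)
              < mean_quantile X tau)%E /\
           (mean_quantile X tau
              < empirical_quantile X w (tau + half_width X I tau alpha w))%E].

(** Inverting the empirical quantile function: [Qhat p < q] compares [p] with the
    left limit of the empirical distribution function at [q], and [q < Qhat p] with
    its value there. *)
Lemma coverage_eventE tau alpha q : mean_quantile X tau = q%:E ->
  coverage_event tau alpha = [set w |
    (tau - half_width X I tau alpha w <= empirical_left_dfun X w q) &&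
    (empirical_dfun X w q < tau + half_width X I tau alpha w)].
Proof.
move=> Qq; rewrite /coverage_event Qq; apply/seteqP.
split => w /=; rewrite empirical_quantile_lt [(q%:E < _)%E]ltNge
  empirical_quantile_le -ltNge.
  by move=> [-> ->].
by move=> /andP[].
Qed.

Lemma measurable_coverage_event tau alpha q : mean_quantile X tau = q%:E ->
  measurable (coverage_event tau alpha).
Proof.
move=> Qq; rewrite (coverage_eventE _ Qq).
pose K : finType := ('I_n + ('I_n + 'I_n))%type.
pose f (k : K) w := match k with
  | inl i => below_quantile X tau w i
  | inr (inl i) => X i w <= q
  | inr (inr i) => X i w < q
  end.
have mf k : measurable [set w | f k w].
  case: k => [i|[i|i]]; first exact: measurable_below_quantile.
    exact: measurable_RV_le.
  exact: measurable_RV_lt.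
pose c (g : {ffun K -> bool}) :=
  Num.sqrt (pair_statistic (block_weight I) [ffun i => g (inl i)])
    * z_quantile alpha / n%:R.
pose Q (g : {ffun K -> bool}) :=
  (tau - c g <= n%:R^-1 * \sum_i (g (inr (inr i)))%:R) &&
  (n%:R^-1 * \sum_i (g (inr (inl i)))%:R < tau + c g).
have := measurable_ffun_event P mf Q; congr measurable.
have cE w : c [ffun k => f k w] = half_width X I tau alpha w.
  rewrite half_widthE /c (_ : [ffun i => _] = below_quantile X tau w) //.
  by apply/ffunP => i; rewrite ffunE ffunE.
have ltE w : \sum_i ([ffun k => f k w] (inr (inr i)))%:R = \sum_i (X i w < q)%R%:R :> R.
  by apply: eq_bigr => i _; rewrite ffunE.
have leE w : \sum_i ([ffun k => f k w] (inr (inl i)))%:R = \sum_i (X i w <= q)%R%:R :> R.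
  by apply: eq_bigr => i _; rewrite ffunE.
by apply/seteqP; split => w /=; rewrite /Q cE ltE leE.
Qed.

End Coverage.

(** * Bounds for a fixed sample size *)

Section CoverageBounds.
Context d (T : measurableType d) (R : realType) (P : probability T R).
Variables (n : nat) (X : 'I_n -> {RV P >-> R}) (I : {set {set 'I_n}}).
Hypothesis n_gt0 : (0 < n)%N.
Hypothesis indepX : independent_RVs X.
Hypothesis cont_mean : continuous (mean_dfun X).
Hypothesis partI : finset.partition I [set: 'I_n]%SET.
Hypothesis cardI : forall A : {set 'I_n}, A \in I -> (2 <= #|A|)%N.
Hypothesis sameF : forall A : {set 'I_n}, A \in I ->
  forall i i' : 'I_n, i \in A -> i' \in A -> forall x, dfun X i x = dfun X i' x.
Variables (tau alpha q q' s eps : R).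
Hypothesis tau_gt0 : 0 < tau.
Hypothesis z_gt0 : 0 < z_quantile alpha.
Hypothesis Qq : mean_quantile X tau = q%:E.
Hypothesis Fq : mean_dfun X q = tau.
Hypothesis qq' : q <= q'.
Hypothesis Fq' : mean_dfun X q' = tau + eps * s ^+ 2 / n%:R.
Hypothesis s_gt0 : 0 < s.
Hypothesis s_var : s ^+ 2 = variance_sum (fun i => dfun X i q).
Hypothesis eps_gt0 : 0 < eps.
Hypothesis eps_small : 14 * eps <= 1.

Local Notation p := (fun i => dfun X i q).
Local Notation p' := (fun i => dfun X i q').
Local Notation t := (eps * s ^+ 2).
Local Notation z := (z_quantile alpha).
Local Notation U := (pair_statistic (block_weight I)).
Local Notation S := (centered_sum p).
Local Notation S' := (centered_sum p').

Let nR_gt0 : 0 < n%:R :> R.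
Proof. by rewrite ltr0n. Qed.

Let eps_le1 : eps <= 1.
Proof. by have := eps_small; have := eps_gt0; lra. Qed.

Let t_gt0 : 0 < t.
Proof. by rewrite mulr_gt0 ?exprn_gt0. Qed.

Let p01 i : 0 <= dfun X i q <= 1 := dfun01 X i q.
Let p'01 i : 0 <= dfun X i q' <= 1 := dfun01 X i q'.

Let weight_supp i j : block_weight I i j != 0 :> R -> dfun X i q = dfun X j q.
Proof.
by move=> /(block_weight_supp partI)[A AI /andP[iA jA]]; exact: sameF AI _ _ iA jA q.
Qed.

(** Chebyshev's inequality with threshold [eps * s ^+ 2] contributes, in units of
    [(eps * s) ^- 2], 1 for the count at [q], 2 for the count at [q'] and 4 for the
    variance estimator. *)
Definition error_bound : R := 7 / (eps ^+ 2 * s ^+ 2).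

Definition bad_below (b : {ffun 'I_n -> bool}) : bool :=
  (t < `|S b|) || (t < `|U b - s ^+ 2|).

Definition bad_event : set T :=
  [set w | bad_below (below X q w)] `|` [set w | t < `|S' (below X q' w)| ].

Lemma measurable_bad_event : measurable bad_event.
Proof.
apply: measurableU; first exact: measurable_below_event.
exact: (measurable_below_event X q' (fun b => t < `|S' b|)).
Qed.

(** [x * (1 - x)] has slope at most 1 on the unit interval. *)
Lemma variance_sum_q'_le : variance_sum p' <= s ^+ 2 + t.
Proof.
have -> : t = \sum_i (dfun X i q' - dfun X i q).
  rewrite sumrB !sum_dfun // Fq Fq' mulrDr [X in _ + X - _]mulrC divfK ?gt_eqF //.
  by rewrite addrAC subrr add0r.
rewrite s_var /variance_sum -big_split; apply: ler_sum => i _ /=.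
have /andP[a0 a1] := p01 i; have /andP[b0 b1] := p'01 i.
have ab := dfun_le X i qq'; nra.
Qed.

Lemma bad_event_le : (P bad_event <= error_bound%:E)%E.
Proof.
have t20 : 0 < t ^+ 2 by rewrite exprn_gt0.
pose A1 := [set w | bad_below (below X q w)].
pose A2 := [set w | t < `|S' (below X q' w)| ].
have mA1 : measurable A1 by exact: measurable_below_event.
have mA2 : measurable A2.
  exact: (measurable_below_event X q' (fun b => t < `|S' b|)).
have U2 : (P bad_event <= P A1 + P A2)%E by exact: measureU2.
apply: (le_trans U2); rewrite (below_event_law indepX q bad_below).
rewrite (below_event_law indepX q' (fun b => t < `|S' b|)).
rewrite -EFinD lee_fin.
have cheb1 := bexp_chebyshev p01 S t_gt0.
have cheb2 := bexp_chebyshev p'01 S' t_gt0.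
have cheb3 := bexp_chebyshev p01 (fun b => U b - s ^+ 2) t_gt0.
rewrite bexp_centered_sum2 -s_var in cheb1.
rewrite bexp_centered_sum2 in cheb2.
have var_U : bexp p (fun b => (U b - s ^+ 2) ^+ 2) <= 4 * s ^+ 2.
  rewrite s_var; apply: pair_statistic_variance => //.
  - exact: block_weight_ge0.
  - exact: block_weight_sym.
  - exact: block_weight_diag.
  - exact: block_weight_row.
have var_S' : variance_sum p' / t ^+ 2 <= 2 * s ^+ 2 / t ^+ 2.
  rewrite ler_wpM2r ?invr_ge0 ?(ltW t20) //.
  have := variance_sum_q'_le; have : t <= 1 * s ^+ 2 by rewrite ler_wpM2r ?sqr_ge0.
  lra.
have {var_U} cheb3' : bexp p (fun b => (t < `|U b - s ^+ 2|)%R%:R) <= 4 * s ^+ 2 / t ^+ 2.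
  by apply: (le_trans cheb3); rewrite ler_wpM2r ?invr_ge0 ?(ltW t20).
have union : bexp p (fun b => (bad_below b)%:R) <=
    bexp p (fun b => (t < `|S b|)%R%:R) + bexp p (fun b => (t < `|U b - s ^+ 2|)%R%:R).
  rewrite -bexpD; apply: ler_bexp => // b; rewrite /bad_below.
  by case: (t < `|S b|); case: (t < `|U b - s ^+ 2|); rewrite /= ?lexx //; lra.
have -> : error_bound = s ^+ 2 / t ^+ 2 + 4 * s ^+ 2 / t ^+ 2 + 2 * s ^+ 2 / t ^+ 2.
  rewrite /error_bound; field; rewrite (lt0r_neq0 s_gt0) (lt0r_neq0 eps_gt0) //.
lra.
Qed.

(** Outside the bad event the estimator at [q] is off by at most [eps * s ^+ 2], and at
    most [3 * eps * s ^+ 2] indicators change when [q] is replaced by the empirical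
    quantile, each with an effect of at most 2; in total [7 * eps * s ^+ 2]. *)
Lemma good_estimator w : ~ bad_event w ->
  (1 - 7 * eps) * s <= Num.sqrt (U (below_quantile X tau w)) <= (1 + 7 * eps) * s.
Proof.
have e14 := eps_small; have e0 := eps_gt0; have tt0 := t_gt0.
move=> /not_orP[/= /negP]; rewrite /bad_below negb_or -!leNgt.
move=> /andP[St Ut] /negP; rewrite -leNgt => S't.
have close := below_quantile_close n_gt0 tau_gt0 Fq Fq' St S't.
have lipU : `|U (below_quantile X tau w) - U (below X q w)| <= 2 * (3 * t).
  apply: (le_trans (pair_statistic_lipschitz _ _ _ _ _)).
  - exact: block_weight_ge0.
  - exact: block_weight_sym.
  - exact: block_weight_row.
  - by rewrite ler_wpM2l.
have s20 : 0 < s ^+ 2 by rewrite exprn_gt0.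
set V := U (below_quantile X tau w) in lipU *.
move: lipU Ut; rewrite !ler_norml => /andP[l1 l2] /andP[u1 u2].
have e2 : eps * (eps * s ^+ 2) <= 1 / 14 * (eps * s ^+ 2).
  by rewrite ler_wpM2r ?(ltW t_gt0) //; lra.
have e3 : 0 <= eps * (eps * s ^+ 2) by rewrite mulr_ge0 // ltW.
have sqrt_s (c : R) : 0 <= c -> c * s = Num.sqrt ((c * s) ^+ 2).
  by move=> c0; rewrite sqrtr_sqr ger0_norm // mulr_ge0 // ltW.
apply/andP; split; rewrite sqrt_s ?ler_wsqrtr //; lra.
Qed.

Lemma measurable_coverage : measurable (coverage_event X I tau alpha).
Proof. exact: measurable_coverage_event Qq. Qed.

Lemma coverage_upper :
  (P (coverage_event X I tau alpha) <=
   (bexp p (fun b => (`|S b| <= z * (1 + 7 * eps) * s)%R%:R) + error_bound)%:E)%E.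
Proof.
rewrite EFinD -(below_event_law indepX q (fun b => `|S b| <= z * (1 + 7 * eps) * s)).
set A := [set w | _].
have mA : measurable A.
  exact: (measurable_below_event X q (fun b => `|S b| <= z * (1 + 7 * eps) * s)).
apply: (@le_trans _ _ (P (A `|` bad_event))); last first.
  apply: (le_trans (measureU2 _ mA measurable_bad_event)).
  by apply: leeD2l; exact: bad_event_le.
apply: le_measure; rewrite ?inE.
- exact: measurable_coverage.
- by apply: measurableU => //; exact: measurable_bad_event.
move=> w Ew; have [|good] := pselect (bad_event w); [by right|left].
move: Ew; rewrite (coverage_eventE I alpha Qq) /= half_widthE //.
have /andP[_ sqrtU] := good_estimator good.
set sU := Num.sqrt _ in sqrtU *.
have zU : sU * z <= (1 + 7 * eps) * s * z by rewrite ler_wpM2r // ltW.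
move=> /andP[lo hi].
have lo' := le_trans lo (empirical_left_dfun_le X w q).
rewrite /A /= centered_sum_below // Fq ler_norml.
have -> : z * (1 + 7 * eps) * s = n%:R * ((1 + 7 * eps) * s * z / n%:R).
  by field; rewrite gt_eqF.
rewrite -mulrN !ler_pM2l //.
have : sU * z / n%:R <= (1 + 7 * eps) * s * z / n%:R.
  by rewrite ler_wpM2r // invr_ge0 ltW.
by move=> ?; apply/andP; split; lra.
Qed.

(** Here the left limit of the empirical distribution function at [q] has to be
    replaced by its value, which is correct unless some observation equals [q]. *)
Lemma coverage_lower :
  ((bexp p (fun b => (`|S b| < z * (1 - 7 * eps) * s)%R%:R) - error_bound)%:E <=
   P (coverage_event X I tau alpha))%E.
Proof.
rewrite EFinB -(below_event_law indepX q (fun b => `|S b| < z * (1 - 7 * eps) * s)).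
set A := [set w | _].
have mA : measurable A.
  exact: (measurable_below_event X q (fun b => `|S b| < z * (1 - 7 * eps) * s)).
set E := coverage_event X I tau alpha.
pose N := [set w | has (fun i => X i w == q) (index_enum 'I_n)].
have [mN PN] : measurable N /\ P N = 0%E by exact: no_atoms.
have mE : measurable E := measurable_coverage.
have mB := measurable_bad_event.
rewrite leeBlDr //.
apply: (@le_trans _ _ (P (E `|` (bad_event `|` N)))); last first.
  have U1 : (P (E `|` (bad_event `|` N)) <= P E + P (bad_event `|` N))%E.
    by apply: measureU2 => //; exact: measurableU.
  have U2 : (P (bad_event `|` N) <= P bad_event + P N)%E by exact: measureU2.
  apply: (le_trans U1); apply: leeD2l; apply: (le_trans U2).
  by rewrite PN adde0 bad_event_le.
apply: le_measure; rewrite ?inE //.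
  by apply: measurableU => //; exact: measurableU.
move=> w Aw; have [|good] := pselect (bad_event w); first by right; left.
have [|noq] := pselect (N w); first by right; right.
left; rewrite /E (coverage_eventE I alpha Qq) /= half_widthE //.
have Xq i : X i w != q.
  by apply/negP => Xiq; apply: noq; apply/hasP; exists i; rewrite ?mem_index_enum.
rewrite empirical_left_dfun_eq //.
have /andP[sqrtU _] := good_estimator good.
set sU := Num.sqrt _ in sqrtU *.
have zU : (1 - 7 * eps) * s * z <= sU * z by rewrite ler_wpM2r // ltW.
move: Aw; rewrite /A /= centered_sum_below // Fq ltr_norml.
have -> : z * (1 - 7 * eps) * s = n%:R * ((1 - 7 * eps) * s * z / n%:R).
  by field; rewrite gt_eqF.
rewrite -mulrN !ltr_pM2l // => /andP[lo hi].
have : (1 - 7 * eps) * s * z / n%:R <= sU * z / n%:R.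
  by rewrite ler_wpM2r // invr_ge0 ltW.
by move=> ?; apply/andP; split; lra.
Qed.

End CoverageBounds.

(** * Asymptotic coverage *)

Section Asymptotics.
Context {R : realType}.

Lemma central_prob_lipschitz (x y : R) : 0 <= x -> x <= y ->
  central_prob y - central_prob x <= 2 * normal_peak 1 * (y - x).
Proof.
move=> x0 xy; rewrite !central_probE ?(le_trans x0) //.
by have := Phi_lipschitz xy; lra.
Qed.

Lemma z_quantileE (alpha : R) : 0 < alpha < 1 ->
  0 < z_quantile alpha /\ central_prob (z_quantile alpha) = 1 - alpha.
Proof.
move=> /andP[a0 a1].
have [|z [z0 Qz Phiz]] := @quantile_PhiE R (1 - alpha / 2).
  by apply/andP; split; lra.
rewrite /z_quantile Qz /=; split => //.
by rewrite central_probE ?(ltW z0) // Phiz; lra.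
Qed.

Context {I : finType}.
Variables (p : I -> R) (s : R).
Hypothesis p01 : forall i, 0 <= p i <= 1.
Hypothesis s_gt0 : 0 < s.

Lemma prob_le_trapezoid (a b : R) : a < b ->
  bexp p (fun x => (`|centered_sum p x| <= a * s)%R%:R)
  <= bexp p (fun x => trapezoid a b (std_sum p s x)).
Proof.
move=> ab; apply: ler_bexp => // x; case: (leP _ (a * s)) => [Sa|_]; last exact: trapezoid_ge0.
rewrite trapezoid_in // /std_sum normrM normfV (gtr0_norm s_gt0).
by rewrite ler_pdivrMr.
Qed.

Lemma trapezoid_le_prob (a b : R) : a < b ->
  bexp p (fun x => trapezoid a b (std_sum p s x))
  <= bexp p (fun x => (`|centered_sum p x| < b * s)%R%:R).
Proof.
move=> ab; apply: ler_bexp => // x; case: (ltP _ (b * s)) => [_|bS]; first exact: trapezoid_le1.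
rewrite trapezoid_out // /std_sum normrM normfV (gtr0_norm s_gt0).
by rewrite ler_pdivlMr.
Qed.

End Asymptotics.

(** Stated for all samples at once, because the threshold on the variance of the
    number of observations below the true quantile is the same for all of them. *)
Lemma coverage_uniform (R : realType) (tau alpha eta : R) :
  0 < tau < 1 -> 0 < alpha < 1 -> 0 < eta ->
  exists2 s0 : R, 0 < s0 &
  forall (d : measure_display) (T : measurableType d) (P : probability T R)
    (n : nat) (X : 'I_n -> {RV P >-> R}) (I : {set {set 'I_n}}),
  (0 < n)%N -> independent_RVs X -> continuous (mean_dfun X) ->
  finset.partition I [set: 'I_n]%SET ->
  (forall A : {set 'I_n}, A \in I -> (2 <= #|A|)%N) ->
  (forall A : {set 'I_n}, A \in I -> forall i i' : 'I_n, i \in A -> i' \in A ->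
    forall x, dfun X i x = dfun X i' x) ->
  s0 ^+ 2 <= n%:R * het_variance X tau ->
  measurable (coverage_event X I tau alpha) /\
  `|(1 - alpha) - fine (P (coverage_event X I tau alpha))| <= eta.
Proof.
move=> /andP[tau0 tau1] alpha01 eta0.
have [z0 Gz] := z_quantileE alpha01; set z := z_quantile alpha in z0 Gz.
pose c : R := normal_peak 1.
have c0 : 0 < c by rewrite normal_peak_gt0 // oner_neq0.
(* [kappa] is the relative error allowed for the estimated standard deviation; the
   second bound keeps its effect on the Gaussian probability below [eta / 4]. *)
pose kappa := Num.min (1 / 4) (eta / (16 * c * z)).
have kappa0 : 0 < kappa by rewrite lt_min; apply/andP; split; [lra|rewrite divr_gt0 ?mulr_gt0].
have kappa4 : kappa <= 1 / 4 by rewrite ge_min lexx.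
have kappa_eta : 4 * c * (kappa * z) <= eta / 4.
  have : kappa <= eta / (16 * c * z) by rewrite ge_min lexx orbT.
  by rewrite ler_pdivlMr ?mulr_gt0 //; lra.
have zk : 0 < z * kappa by rewrite mulr_gt0.
have zk4 : z * kappa <= z * (1 / 4) by rewrite ler_wpM2l // ltW.
(* The bounds for a fixed sample size use a relative error of [7 * eps]. *)
pose eps := kappa / 7.
have eps0 : 0 < eps by rewrite divr_gt0.
have eps14 : 14 * eps <= 1 by rewrite /eps; lra.
have eps7 : 7 * eps = kappa by rewrite /eps; lra.
have eta4 : 0 < eta / 4 by rewrite divr_gt0.
have lo0 : 0 <= z * (1 - 2 * kappa) by lra.
have up0 : 0 <= z * (1 + kappa) by lra.
have lo_lt : z * (1 - 2 * kappa) < z * (1 - kappa) by lra.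
have up_lt : z * (1 + kappa) < z * (1 + 2 * kappa) by lra.
have [s1 s10 Hup] := clt_trapezoid up0 up_lt eta4.
have [s2 s20 Hlo] := clt_trapezoid lo0 lo_lt eta4.
have G_up : central_prob (z * (1 + 2 * kappa)) <= (1 - alpha) + eta / 4.
  have := @central_prob_lipschitz R z (z * (1 + 2 * kappa)) (ltW z0) ltac:(lra).
  by rewrite Gz -/c; lra.
have G_lo : (1 - alpha) - eta / 4 <= central_prob (z * (1 - 2 * kappa)).
  have := @central_prob_lipschitz R (z * (1 - 2 * kappa)) z lo0 ltac:(lra).
  by rewrite Gz -/c; lra.
pose s3 := 1 + 28 / (eps ^+ 2 * eta).
have s3_gt0 : 0 < 28 / (eps ^+ 2 * eta) by rewrite divr_gt0 ?mulr_gt0 ?exprn_gt0.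
pose s0 := Num.max (Num.max s1 s2) s3.
have s00 : 0 < s0 by rewrite !lt_max s10.
exists s0 => // d T P n X I n0 indepX cont_mean partI cardI sameF s0V.
have nR0 : 0 < n%:R :> R by rewrite ltr0n.
have [q Qq Fq] := mean_quantileE n0 cont_mean (introT andP (conj tau0 tau1)).
pose s := Num.sqrt (n%:R * het_variance X tau).
have nV_ge0 : 0 <= n%:R * het_variance X tau := le_trans (sqr_ge0 _) s0V.
have s0s : s0 <= s.
  by rewrite -[s0]gtr0_norm // -sqrtr_sqr ler_wsqrtr.
have s_gt0 : 0 < s := lt_le_trans s00 s0s.
have s_var : s ^+ 2 = variance_sum (fun i => dfun X i q).
  by rewrite sqr_sqrtr // /het_variance Qq /= mulrA mulfV ?mul1r ?gt_eqF.
have s1s : s1 <= s by rewrite (le_trans _ s0s) // !le_max lexx.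
have s2s : s2 <= s by rewrite (le_trans _ s0s) // !le_max lexx orbT.
have s3s : s3 <= s by rewrite (le_trans _ s0s) // !le_max lexx orbT.
have p01 i : 0 <= dfun X i q <= 1 := dfun01 X i q.
have var_le : s ^+ 2 <= n%:R * (1 - tau).
  rewrite s_var mulrBr mulr1 -Fq -sum_dfun // -[X in X%:R]card_ord -sumr_const -sumrB.
  apply: ler_sum => i _; have /andP[f0 f1] := p01 i.
  by rewrite ler_piMl ?subr_ge0.
have shift0 : 0 < eps * s ^+ 2 / n%:R by rewrite divr_gt0 ?mulr_gt0 ?exprn_gt0.
have shift1 : tau + eps * s ^+ 2 / n%:R < 1.
  rewrite -ltrBrDl ltr_pdivrMr // [X in _ < X]mulrC.
  apply: (@lt_le_trans _ _ (1 * s ^+ 2)); last by rewrite mul1r.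
  by rewrite ltr_pM2r ?exprn_gt0 //; lra.
(* Such a [q'] exists because the variance is at most [n * (1 - tau)]. *)
have [q' Qq' Fq'] := mean_quantileE n0 cont_mean
  (introT andP (conj (addr_gt0 tau0 shift0) shift1)).
have qq' : q <= q'.
  rewrite leNgt; apply/negP => /ltW/(mean_dfun_le X).
  by rewrite Fq Fq' leNgt ltrDl shift0.
have up := coverage_upper n0 indepX partI cardI sameF tau0 z0 Qq Fq qq' Fq' s_gt0 s_var eps0 eps14.
have lo := coverage_lower n0 indepX cont_mean partI cardI sameF tau0 z0 Qq Fq qq' Fq' s_gt0 s_var eps0 eps14.
have mE := measurable_coverage_event partI alpha Qq; split => //.
have Efin : P (coverage_event X I tau alpha) \is a fin_num by exact: fin_num_measure.
rewrite -(fineK Efin) !lee_fin eps7 -/z in up lo.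
have error_le : error_bound s eps <= eta / 4.
  rewrite /error_bound ler_pdivrMr ?mulr_gt0 ?exprn_gt0 //.
  have s_le : s <= s ^+ 2 by rewrite expr2 ler_peMl ?(ltW s_gt0) // (le_trans _ s3s) // lerDl ltW.
  have : 28 / (eps ^+ 2 * eta) <= s ^+ 2.
    by apply: (le_trans _ s_le); apply: (le_trans _ s3s); rewrite lerDr.
  by rewrite ler_pdivrMr ?mulr_gt0 ?exprn_gt0 //; lra.
have /andP[_ clt_up] := Hup _ _ _ p01 s_var s1s.
have /andP[clt_lo _] := Hlo _ _ _ p01 s_var s2s.
have trap_up := prob_le_trapezoid p01 s_gt0 up_lt.
have trap_lo := trapezoid_le_prob p01 s_gt0 lo_lt.
move: up lo error_le clt_up clt_lo trap_up trap_lo G_up G_lo; clear.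
by rewrite ler_norml => *; apply/andP; split; lra.
Qed.

Theorem mainTheorem2 (R : realType) (d : nat -> measure_display)
    (T : forall n : nat, measurableType (d n))
    (P : forall n : nat, probability (T n) R)
    (X : forall n : nat, 'I_n -> {RV (P n) >-> R})
    (I : forall n : nat, {set {set 'I_n}})
    (tau : R)
    (indepX : forall n : nat, (2 <= n)%N -> independent_RVs (X n))
    (cont_mean : forall n : nat, (2 <= n)%N -> continuous (mean_dfun (X n)))
    (partI : forall n : nat, (2 <= n)%N -> finset.partition (I n) [set: 'I_n]%SET)
    (cardI : forall n : nat, (2 <= n)%N ->
      forall A : {set 'I_n}, A \in I n -> (2 <= #|A|)%N)
    (sameF : forall n : nat, (2 <= n)%N ->
      forall A : {set 'I_n}, A \in I n ->
      forall i i' : 'I_n, i \in A -> i' \in A ->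
      forall x : R, dfun (X n) i x = dfun (X n) i' x)
    (tau01 : 0 < tau < 1)
    (nV_infty : (n%:R * het_variance (X n) tau) @[n --> \oo] --> +oo) :
  forall alpha : R, 0 < alpha < 1 ->
    P n [set w : T n |
          (empirical_quantile (X n) w
             (tau - half_width (X n) (I n) tau alpha w)
             < mean_quantile (X n) tau)%E /\
          (mean_quantile (X n) tau
             < empirical_quantile (X n) w
                 (tau + half_width (X n) (I n) tau alpha w))%E]
      @[n --> \oo] --> (1 - alpha)%:E.
Proof.
move=> alpha alpha01.
have near_cov eta : 0 < eta -> \forall n \near \oo,
    measurable (coverage_event (X n) (I n) tau alpha) /\
    `|(1 - alpha) - fine (P n (coverage_event (X n) (I n) tau alpha))| <= eta.
  move=> eta0; have [s0 s00 Hs0] := coverage_uniform tau01 alpha01 eta0.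
  near=> n.
  have n2 : (2 <= n)%N by near: n; exists 2.
  apply: Hs0.
  - exact: ltn_trans n2.
  - exact: indepX.
  - exact: cont_mean.
  - exact: partI.
  - exact: cardI.
  - exact: sameF.
  by near: n; move/cvgryPge: nV_infty; exact.
apply/fine_cvgP; split.
  have near_meas := near_cov 1 ltr01; near=> n.
  apply: fin_num_measure; near: n.
  by apply: filterS near_meas => n [].
apply/cvgrPdist_le => eta eta0.
by apply: filterS (near_cov _ eta0) => n [].
Unshelve. all: by end_near. Qed.
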